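(* For any infinite field $\mathbb{K}$ one has $\alpha(\mathbb{K},4)=\frac{3-\sqrt5}{2}$ and $\alpha(\mathbb{K},5)=\frac13$. Moreover, for any field $\mathbb{K}$ of characteristic $0$, $$\tfrac14\le\alpha(\mathbb{K},\infty)\le\alpha(\mathbb{K},6)\le\tfrac{5}{16}.$$
   Context: $\mathbb{N}=\{1,2,\dots\}$. A quadratic $\mathbb{K}$-algebra with $n$ generators and $d$ relations ($0\le d\le n^2$) is $R=\mathbb{K}\langle x_1,\dots,x_n\rangle/I$, where all $x_i$ have degree $1$ and $I$ is the two-sided ideal generated by $d$ linearly independent homogeneous elements of degree $2$; it is graded, $R=\bigoplus_{q\ge0}R_q$. Put $$h_q(\mathbb{K},n,d)=\min_{R}\dim_{\mathbb{K}} R_q,$$ the minimum over all quadratic $\mathbb{K}$-algebras $R$ with $n$ generators and $d$ relations. For $q\in\mathbb{N}$, $q\ge2$, put $$d(\mathbb{K},n,q)=\min\{d\in\mathbb{N}:h_q(\mathbb{K},n,d)=0\},$$ and put $$d(\mathbb{K},n,\infty)=\min\Bigl\{d\in\mathbb{N}:\min_{q\in\mathbb{N}}h_q(\mathbb{K},n,d)=0\Bigr\}.$$ For $q\in\mathbb{N}$, $q\ge 2$, or $q=\infty$, define $\alpha(\mathbb{K},q)=\lim_{n\to\infty}\frac{d(\mathbb{K},n,q)}{n^2}$ (the limit exists). *)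

(* Defs.v *)
From mathcomp Require Import all_boot all_order all_algebra.
From mathcomp Require Import all_classical all_reals all_analysis.
From mathcomp Require monalg.
(* The notations of monalg clash with those of the analysis library. *)
Import -(notations) monalg.
Import Order.TTheory GRing.Theory Num.Theory.
Import numFieldNormedType.Exports.

Set Implicit Arguments.
Unset Strict Implicit.
Unset Printing Implicit Defensive.

Local Open Scope classical_set_scope.
Local Open Scope ring_scope.

(* K<x_1, ..., x_n>: the algebra of the free monoid of words in n letters. *)
Definition free_alg (K : fieldType) (n : nat) := malg (fmonom 'I_n) K.

Section QuadraticAlgebras.
Variables (K : fieldType) (n : nat).
Local Notation A := (free_alg K n).
Implicit Types (I : set A) (f : A) (q d m : nat).

Definition homog q : set A :=
  [set f | forall w : fmonom 'I_n, mcoeff w f != 0 -> fdeg w = q].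

Definition two_sided_ideal I : Prop :=
  [/\ I 0,
      forall f g, I f -> I g -> I (f + g),
      forall a f : A, I f -> I (a * f)
    & forall f b : A, I f -> I (f * b)].

Definition ideal_gen (G : set A) : set A := smallest two_sided_ideal G.

(* The classes of u_0, ..., u_(m-1) in A / I are linearly independent. *)
Definition free_mod I m (u : 'I_m -> A) : Prop :=
  forall c : 'I_m -> K, I (\sum_i c i *: u i) -> forall i, c i = 0.

Definition quadratic_relations d (r : 'I_d -> A) : Prop :=
  (forall i, homog 2%N (r i)) /\ free_mod [set 0] r.

(* dim (A / I)_q = m, where (A / I)_q is the image of the degree q component
   of A: there are m elements of degree q whose classes form a basis. *)
Definition quot_dim I q m : Prop :=
  exists u : 'I_m -> A,
    [/\ forall i, homog q (u i),
        free_mod I u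
      & forall f, homog q f -> exists c : 'I_m -> K, I (f - \sum_i c i *: u i)].

Definition quadratic_dims d q : set nat :=
  [set m | exists2 r : 'I_d -> A,
     quadratic_relations r & quot_dim (ideal_gen (range r)) q m].

End QuadraticAlgebras.

(* The least element of P; the value 0 for empty P is never relevant below:
   when 0 < n, and 2 <= q or q is infinite, all the sets it is applied to
   are nonempty (the relation count d is kept between 0 and n ^ 2 for this
   reason). *)
Definition nat_min (P : set nat) : nat :=
  xget 0%N [set m | P m /\ forall k, P k -> (m <= k)%N].

Definition h (K : fieldType) (q n d : nat) : nat :=
  nat_min (quadratic_dims K n d q).

(* d(K, n, q), with q = None standing for q = infinity. *)
Definition d_min (K : fieldType) (n : nat) (q : option nat) : nat :=
  nat_min [set d | (1 <= d <= n ^ 2)%N /\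
    match q with
    | Some q => h K q n d = 0%N
    | None => nat_min [set h K q n d | q in [set q | (1 <= q)%N]] = 0%N
    end].

Definition density (R : realType) (K : fieldType) (q : option nat) : R^nat :=
  fun n => (d_min K n q)%:R / n%:R ^+ 2.

Definition alpha (R : realType) (K : fieldType) (q : option nat) : R :=
  limn (density R K q).

(* lim defaults to 0, so asserting a nonzero value of alpha includes the
   convergence of the sequence. *)
Lemma alpha_neq0_cvg (R : realType) (K : fieldType) (q : option nat) :
  alpha R K q != 0 -> density R K q @ \oo --> alpha R K q.
Proof.
move=> a0; apply: contrapT => Ncv; move/eqP: a0; apply.
by rewrite /alpha dvgP // => /Ncv.
Qed.

(* Main.v *)
Require Import Defs.
From mathcomp Require Import all_boot all_order all_algebra.
From mathcomp Require Import all_classical all_reals all_analysis.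
From mathcomp Require Import zify ring lra.
From mathcomp Require monalg.
(* The notations of monalg clash with those of the analysis library. *)
Import -(notations) monalg.
Import Order.TTheory GRing.Theory Num.Theory.
Import numFieldNormedType.Exports.
Local Open Scope classical_set_scope.
Local Open Scope ring_scope.

(** Let R be the quotient of the free algebra by relations with coefficients
    c e i j (e the relation, i and j the letters).  The dual of R_q is the space
    of the functions t on words of length q such that
        sum over i, j of  c e i j * t (u i j v)  = 0   for all u, e, v,
    so R_q = 0 exactly when the only such function is 0 ([nil_at], and
    [quadratic_nil_at], [nilpotent_algebra] for the passage to ideals of the
    free algebra).  In this form most constructions of algebras with R_q = 0
    are verified by looking at one such t.

    Existence and shape of the limit.  If n generators and d relations suffice
    for R_q = 0, then so do n m generators and d m^2 relations (replace each
    letter by m copies), and k further generators can be killed by 2 k (n + k)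
    monomial relations.  Hence d(n) / n^2 converges to its infimum
    ([density_cvg]): one algebra with R_q = 0 bounds alpha from above by
    d / n^2 ([alpha_le]), and a bound d >= a n^2 for all such algebras bounds it
    from below by a ([alpha_ge]).

    Lower bounds.  With s_k = dim R_k one has s_(k+1) >= n s_k - d s_(k-1), so a
    lower bound x n for s_k / s_(k-1) becomes the lower bound n - d / (x n) for
    the next quotient ([golod_shafarevich]).  Starting from x = 1 with
    d = a n^2, the sequence x, 1 - a / x, ... is 1, 1 - b, b, 0 for
    a = b = (3 - sqrt 5) / 2 and 1, 2/3, 1/2, 1/3, 0 for a = 1/3; for
    a = 1/4 the value x = 1/2 is a fixed point, and R_k never vanishes.

    Upper bounds in degrees 5 and 6.  It suffices to exhibit an algebra with 3
    generators, 3 relations and R_5 = 0, and one with 4 generators, 5 relations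
    and R_6 = 0.  They are checked by a verified elimination, degree by degree
    ([nil_checkP]).  For
    degree 5 only pivots 1 and -1 occur, so the integer computation is valid
    over every field; for degree 6 the elimination is done modulo 2, and a
    system of integer equations with only the zero solution modulo 2 has only
    the zero solution in characteristic 0 ([nil_at_specialize]).

    Upper bound in degree 4.  Suppose first that each of the three pairs of
    neighbouring letters of a word of length 4 could have its own relations.
    Split the letters as A + B with a and b elements.  Let the middle pair
    satisfy t(x, y) = 0 for x, y in A (a^2 relations), and the outer pairs
    t(x, y) = t(y, x) for x in A, y in B and t(x, y) = 0 for x, y in B
    ((a + b) b relations).  A function on pairs obeying the latter is 0 as soon
    as it vanishes on A x (A + B) or on (A + B) x A, and using this on the last
    pair and then on the first shows t = 0 ([nil_at_alternating]).  For
    a / b near the golden ratio both numbers of relations are near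
    (3 - sqrt 5) / 2 times (a + b)^2.  To use different relations at different
    places, take m blocks of letters, one system of relations for each ordered
    pair of distinct blocks, and kill all products inside a block, at
    negligible cost for large m.  For a given sequence of blocks the system of
    the middle pair is independent of those of the outer pairs, so some choice
    of coefficients is good for that sequence; being good is a nonvanishing
    polynomial condition, so over an infinite field some choice is good for all
    sequences at once ([nil_at_generic]). *)

Set Implicit Arguments.
Unset Strict Implicit.
Unset Printing Implicit Defensive.

(** * Functions on words killed by quadratic relations *)

(** The coefficients may depend on the number of letters to the left of the pair
    they are applied to; this is what lets words in several blocks of letters be
    treated one sequence of blocks at a time. *)
Definition annihilates (R : nzRingType) (T E : finType)
    (c : nat -> E -> T -> T -> R) (q : nat) (t : seq T -> R) : Prop :=
  forall u e v, (size u + size v).+2 = q ->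
    \sum_i \sum_j c (size u) e i j * t (u ++ [:: i, j & v]) = 0.

Definition nil_at (R : nzRingType) (T E : finType)
    (c : nat -> E -> T -> T -> R) (q : nat) : Prop :=
  forall t, annihilates c q t -> forall w, size w = q -> t w = 0.

Lemma eq_nil_at (R : nzRingType) (T E : finType)
    (c c' : nat -> E -> T -> T -> R) q :
  (forall r e i j, c r e i j = c' r e i j) -> nil_at c q -> nil_at c' q.
Proof.
move=> cc'; suff -> : c = c' by [].
by do 2 (apply/funext=> ?); apply/funext=> ?; apply/funext=> ?; apply: cc'.
Qed.

(** For coefficients independent of the place, functions killed in all lengths at
    once are stable under fixing a prefix or a suffix. *)
Definition kills (R : nzRingType) (T E : finType) (c : E -> T -> T -> R)
    (t : seq T -> R) : Prop :=
  forall u e v, \sum_i \sum_j c e i j * t (u ++ [:: i, j & v]) = 0.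

(** A function killed in length q extends by 0 to the other lengths. *)
Lemma nil_at_kills (R : nzRingType) (T E : finType) (c : E -> T -> T -> R) q :
  nil_at (fun=> c) q <->
  (forall t, kills c t -> forall w, size w = q -> t w = 0).
Proof.
split=> [nilc t kt|nilc t ann w wq]; first by apply: nilc => u e v _; apply: kt.
pose t' w := if size w == q then t w else 0.
suff /nilc/(_ w wq) : kills c t' by rewrite /t' wq eqxx.
move=> u e v; rewrite /t'.
under eq_bigr => i _ do under eq_bigr => j _ do rewrite size_cat /= !addnS.
case: eqP => [/ann->//|_].
by rewrite big1 // => i _; rewrite big1 // => j _; rewrite mulr0.
Qed.

Lemma sum2_delta (R : nzRingType) (T : finType) (a b : T) (F : T -> T -> R) :
  \sum_i \sum_j ((i == a) && (j == b))%:R * F i j = F a b.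
Proof.
rewrite (bigD1 a) //= (bigD1 b) //= !eqxx mul1r big1 => [|j /negPf->]; last by rewrite mul0r.
rewrite big1 ?addr0 // => i /negPf ia.
by rewrite big1 // => j _; rewrite ia mul0r.
Qed.

Lemma sum_pair (R : nmodType) (I J : finType) (F : I * J -> R) :
  \sum_x F x = \sum_i \sum_j F (i, j).
Proof. by rewrite pair_bigA; apply: eq_bigr => -[]. Qed.

Lemma split2 (T : Type) (s : seq T) m n : (m + n).+2 = size s ->
  exists s1 a b s2, [/\ s = s1 ++ [:: a, b & s2], size s1 = m & size s2 = n].
Proof.
move=> sE; have : size (drop m s) = n.+2 by rewrite size_drop -sE -!addnS addKn.
case dE: (drop m s) => [|a [|b s2]] //= [s2n].
exists (take m s), a, b, s2; rewrite -dE cat_take_drop.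
by split=> //; rewrite size_takel // -sE -!addnS leq_addr.
Qed.

(** Coordinates k beyond the cardinal of E carry no relation, so fewer than d
    relations can be presented as d of them. *)
Definition slot (E : finType) (k : nat) : option E := nth None (map some (enum E)) k.

Lemma slotP (E : finType) (e : E) : slot E (enum_rank e) = Some e.
Proof. by rewrite /slot (nth_map e) ?nth_enum_rank // -cardE. Qed.

Definition nilpotent (K : fieldType) (q n d : nat) : Prop :=
  exists c : 'I_d -> 'I_n -> 'I_n -> K, nil_at (fun=> c) q.

Lemma nilpotent_card (K : fieldType) (T E : finType) (c : E -> T -> T -> K) q d :
  (#|E| <= d)%N -> nil_at (fun=> c) q -> nilpotent K q #|T| d.
Proof.
move=> Ed /nil_at_kills nilc.
pose c' (k : 'I_d) (i j : 'I_#|T|) : K :=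
  if slot E k is Some e then c e (enum_val i) (enum_val j) else 0.
exists c'; apply/nil_at_kills => t kt w wq.
have -> : w = map enum_rank (map enum_val w).
  by rewrite -map_comp map_id_in // => i _ /=; rewrite enum_valK.
apply: (nilc (t \o map enum_rank)); last by rewrite size_map.
move=> u e v.
have eP : (enum_rank e < d)%N by apply: leq_trans Ed.
rewrite -[RHS](kt (map enum_rank u) (Ordinal eP) (map enum_rank v)).
rewrite (reindex _ (onW_bij _ (@enum_val_bij T))); apply: eq_bigr => i _ /=.
rewrite (reindex _ (onW_bij _ (@enum_val_bij T))); apply: eq_bigr => j _ /=.
by rewrite map_cat /= !enum_valK /c' /= slotP.
Qed.

(** * Blowing up and adding letters *)

(** For fixed second components of the letters, t is a function on words in the
    old letters killed by the old relations. *)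
Lemma nilpotent_blowup (K : fieldType) q n d m :
  nilpotent K q n d -> nilpotent K q (n * m) (d * m ^ 2).
Proof.
move=> [c nilc].
pose c' (e : 'I_d * ('I_m * 'I_m)) (x y : 'I_n * 'I_m) : K :=
  ((x.2 == e.2.1) && (y.2 == e.2.2))%:R * c e.1 x.1 y.1.
have <- : #|{: 'I_n * 'I_m}| = (n * m)%N by rewrite card_prod !card_ord.
apply: (nilpotent_card (c := c')); first by rewrite !card_prod !card_ord mulnn.
move=> t ann w wq; rewrite -[w]zip_unzip.
have wq1 : size (unzip1 w) = q by rewrite size_map.
have wq2 : size (unzip2 w) = q by rewrite size_map.
move: (unzip1 w) (unzip2 w) wq1 wq2 => u s uq sq {w wq}.
apply: (nilc (fun u => t (zip u s))) => // {u uq} u e v uvq.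
have [|s1 [a [b [s2 [sE s1u s2v]]]]] := @split2 _ s (size u) (size v).
  by rewrite sq.
rewrite -[RHS](ann (zip u s1) (e, (a, b)) (zip v s2)); last first.
  by rewrite !size_zip s1u s2v !minnn.
rewrite sum_pair; apply: eq_bigr => i _.
under [RHS]eq_bigr => a' _ do rewrite sum_pair.
rewrite exchange_big /=; apply: eq_bigr => j _; rewrite /c' /=.
under [RHS]eq_bigr => a' _ do under eq_bigr => b' _ do rewrite -mulrA.
rewrite (sum2_delta a b (fun a' b' =>
  c e i j * t (zip u s1 ++ [:: (i, a'), (j, b') & zip v s2]))).
by rewrite sE zip_cat.
Qed.

(** The added relations are the products with a new letter as one of the
    factors, so t vanishes on every word with a new letter; length at least 2 is
    needed for such a letter to have a neighbour. *)
Lemma nilpotent_extend (K : fieldType) q n d k : (1 < q)%N ->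
  nilpotent K q n d -> nilpotent K q (n + k) (d + 2 * k * (n + k)).
Proof.
move=> q_gt1 [c /nil_at_kills nilc].
pose T : finType := ('I_n + 'I_k)%type.
pose c' (e : 'I_d + (T * 'I_k + 'I_k * T)) (x y : T) : K :=
  match e, x, y with
  | inl e', inl i, inl j => c e' i j
  | inl _, _, _ => 0
  | inr (inl (y0, b)), _, _ => ((x == y0) && (y == inr b))%:R
  | inr (inr (b, y0)), _, _ => ((x == inr b) && (y == y0))%:R
  end.
have <- : #|T| = (n + k)%N by rewrite card_sum !card_ord.
apply: (nilpotent_card (c := c')).
  by rewrite !(card_sum, card_prod) !card_ord; lia.
apply/nil_at_kills => t kt w wq.
have new_last u b y v : t (u ++ [:: y, inr b & v]) = 0.
  by rewrite -[RHS](kt u (inr (inl (y, b))) v) sum2_delta.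
have new_first u b y v : t (u ++ [:: inr b, y & v]) = 0.
  by rewrite -[RHS](kt u (inr (inr (b, y))) v) sum2_delta.
have [old|] := boolP (all (fun x : T => if x is inl _ then true else false) w).
  have [u wE] : exists u, w = map inl u.
    elim: (w) old => [|[i|//] w' IHw] /=; first by exists [::].
    by move=> /IHw[u ->]; exists (i :: u).
  rewrite wE; apply: (nilc (t \o map inl)); last by rewrite -wq wE size_map.
  move=> u' e v; rewrite -[RHS](kt (map inl u') (inl e) (map inl v)).
  rewrite big_sumType /= [X in _ + X]big1 ?addr0 => [|x _]; last first.
    by rewrite big1 // => y _; rewrite mul0r.
  apply: eq_bigr => i _; rewrite big_sumType /= [X in _ + X]big1 ?addr0 => [|x _].
    by apply: eq_bigr => j _; rewrite map_cat.
  by rewrite mul0r.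
rewrite -has_predC => /hasP[x xw]; case: x xw => // b xw _.
case/splitPr: xw wq => u [|y v] wq; last exact: new_first.
case/lastP: u wq => [|u y] wq; first by rewrite -wq in q_gt1.
by rewrite -cats1 -catA; apply: new_last.
Qed.

Lemma nilpotent_all (K : fieldType) q n : (1 < q)%N -> nilpotent K q n (n ^ 2).
Proof.
move=> q_gt1.
pose c (e : 'I_n * 'I_n) (i j : 'I_n) : K := ((i == e.1) && (j == e.2))%:R.
have := @nilpotent_card K _ _ c q (n ^ 2); rewrite card_ord; apply.
  by rewrite card_prod !card_ord mulnn.
apply/nil_at_kills => t kt [|i [|j w]] wq; rewrite -?wq // in q_gt1.
by rewrite -[RHS](kt [::] (i, j) w) sum2_delta.
Qed.

(** * Changing the ring of coefficients *)

Section Specialization.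
Variables (T E : finType) (q : nat).

(** An equation is given by the position of the pair, the relation, and a word of
    which only the letters outside that pair matter. *)
Definition eqn_index := ('I_q.-1 * E * q.-tuple T)%type.

Definition probe (x : eqn_index) (i j : T) : seq T :=
  take x.1.1 x.2 ++ [:: i, j & drop x.1.1.+2 x.2].

Definition eqn_mx (R : nzRingType) (c : nat -> E -> T -> T -> R) :
    'M[R]_(#|{: q.-tuple T}|, #|{: eqn_index}|) :=
  \matrix_(a, k) let x : eqn_index := enum_val k in
     \sum_i \sum_j c x.1.1 x.1.2 i j * (tval (enum_val a) == probe x i j)%:R.

(** The extension by 0 to all words of the function with values v on the words of
    length q. *)
Definition word_fun (R : nzRingType) (v : 'rV[R]_#|{: q.-tuple T}|) (w : seq T) : R :=
  \sum_a v 0 a * (tval (enum_val a) == w)%:R.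

Lemma word_fun_tuple (R : nzRingType) (v : 'rV[R]_#|{: q.-tuple T}|) a :
  word_fun v (tval (enum_val a)) = v 0 a.
Proof.
rewrite /word_fun (bigD1 a) //= eqxx mulr1 big1 ?addr0 // => b /negPf ba.
by rewrite (inj_eq val_inj) (inj_eq enum_val_inj) ba mulr0.
Qed.

Let probe_le r : (r < q.-1)%N -> (r.+2 <= q)%N.
Proof. by case: (q) => // q'; rewrite ltnS. Qed.

Lemma mulmx_eqn_mx (R : comNzRingType) (c : nat -> E -> T -> T -> R) v k :
  (v *m eqn_mx c) 0 k = let x : eqn_index := enum_val k in
  \sum_i \sum_j c x.1.1 x.1.2 i j * word_fun v (probe x i j).
Proof.
rewrite mxE /=; under eq_bigr => a _ do rewrite mxE mulr_sumr.
rewrite exchange_big /=; apply: eq_bigr => i _.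
under eq_bigr => a _ do rewrite mulr_sumr.
rewrite exchange_big /=; apply: eq_bigr => j _.
by rewrite /word_fun mulr_sumr; apply: eq_bigr => a _; rewrite mulrCA.
Qed.

Lemma annihilates_word_fun (R : comNzRingType) (c : nat -> E -> T -> T -> R) v :
  v *m eqn_mx c = 0 <-> annihilates c q (word_fun v).
Proof.
split=> [v0 u e w uw|ann].
  have [i0 _|T0] := pickP (xpredT : pred T); last first.
    by rewrite big1 // => i _; have := T0 i.
  have rP : (size u < q.-1)%N by rewrite -uw /= ltnS leq_addr.
  have sP : size (u ++ [:: i0, i0 & w]) == q by rewrite size_cat /= !addnS uw.
  pose x : eqn_index := (Ordinal rP, e, Tuple sP).
  have dropE : drop (size u).+2 (u ++ [:: i0, i0 & w]) = w.
    by rewrite drop_cat ltnNge -addn2 leq_addr /= addKn /= drop0.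
  have := congr1 (fun M : 'rV_ _ => M 0 (enum_rank x)) v0.
  by rewrite mulmx_eqn_mx !mxE enum_rankK /= /probe /= dropE take_size_cat.
apply/rowP => x; rewrite mulmx_eqn_mx !mxE.
set y : eqn_index := enum_val x; case: y => [[[r r_lt] e] y] /=; have rq := probe_le r_lt.
have su : size (take r y) = r by rewrite size_takel ?size_tuple //; lia.
rewrite -[X in c X](su); apply: ann.
by rewrite su size_drop size_tuple /=; lia.
Qed.

(** Semicontinuity.  Over the field F the system has a right inverse B; the
    determinant delta of the system times a lift of B specializes to 1 in F, and
    its nonvanishing in F' makes the system injective over F'. *)
Lemma nil_at_specialize (R : comNzRingType) (F : fieldType)
    (phi : {rmorphism R -> F}) (c : nat -> E -> T -> T -> R) :
    (forall y, exists x, phi x = y) ->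
    nil_at (fun r e i j => phi (c r e i j)) q ->
  exists delta : R, phi delta != 0 /\
    forall (F' : fieldType) (psi : {rmorphism R -> F'}), psi delta != 0 ->
      nil_at (fun r e i j => psi (c r e i j)) q.
Proof.
move=> phi_surj nilc.
have map_eqn (S : comNzRingType) (f : {rmorphism R -> S}) :
    map_mx f (eqn_mx c) = eqn_mx (fun r e i j => f (c r e i j)).
  apply/matrixP => a k; rewrite !mxE rmorph_sum; apply: eq_bigr => i _.
  rewrite rmorph_sum; apply: eq_bigr => j _.
  by rewrite rmorphM rmorph_nat.
have /row_freeP[B AB] : row_free (map_mx phi (eqn_mx c)).
  apply: inj_row_free => v; rewrite map_eqn => /annihilates_word_fun annv.
  apply/rowP => a; rewrite -word_fun_tuple mxE.
  by apply: nilc => //; rewrite size_tuple.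
have [lift liftK] := choice phi_surj.
have mapB : map_mx phi (map_mx lift B) = B.
  by apply/matrixP => a b; rewrite !mxE liftK.
exists (\det (eqn_mx c *m map_mx lift B)); split.
  by rewrite -det_map_mx map_mxM mapB AB det1 oner_neq0.
move=> F' psi; rewrite -det_map_mx map_mxM -unitfE -unitmxE => unitAB t ann w wq.
pose v : 'rV_#|{: q.-tuple T}| := \row_a t (tval (enum_val a)).
have tv u : size u = q -> t u = word_fun v u.
  move=> /eqP uq; rewrite -[u in RHS]/(tval (Tuple uq)) -[Tuple uq]enum_rankK.
  by rewrite word_fun_tuple mxE enum_rankK.
have v0 : v *m map_mx psi (eqn_mx c) = 0.
  rewrite map_eqn; apply/annihilates_word_fun => u e u' uu'.
  rewrite -[RHS](ann u e u' uu'); apply: eq_bigr => i _; apply: eq_bigr => j _.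
  by rewrite tv // size_cat /= !addnS.
have vE : v = 0.
  by rewrite -[v](mulmxK unitAB) mulmxA v0 mul0mx mul0mx.
by rewrite tv // vE /word_fun big1 // => a _; rewrite mxE mul0r.
Qed.
End Specialization.

Lemma infinite_nonroot (K : fieldType) (p : {poly K}) :
  infinite_set [set: K] -> p != 0 -> exists x, p.[x] != 0.
Proof.
move=> K_inf p_neq0; apply: contrapT => no_x.
have [B _ sizeB] := infinite_set_fset (size p) K_inf.
have := max_poly_roots p_neq0 _ (finmap.fset_uniq B).
rewrite ltnNge sizeB => /(_ _)/negP; apply=> //.
by apply/allP => x _; apply/rootP; apply: contrapT => /eqP px; apply: no_x; exists x.
Qed.

(** Each w prescribes which parameters occur as which coefficients.  On the line
    through a point p good for all but one w and a point p' good for the remaining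
    one, each w is good outside the zeros of a nonzero polynomial. *)
Lemma nil_at_generic (K : fieldType) (T E : finType) (X : Type) (W : eqType)
    (sigma : W -> nat -> E -> T -> T -> X) q (ws : seq W) :
    infinite_set [set: K] ->
    (forall w, w \in ws ->
       exists p : X -> K, nil_at (fun r e i j => p (sigma w r e i j)) q) ->
  exists p : X -> K,
    forall w, w \in ws -> nil_at (fun r e i j => p (sigma w r e i j)) q.
Proof.
move=> K_inf; elim: ws => [|w ws IHws] nilw; first by exists (fun=> 0).
have [p nilp] := IHws (fun w' w'ws => nilw w' (@mem_behead _ (w :: ws) _ w'ws)).
have [p' nilp'] := nilw w (mem_head _ _); clear IHws nilw.
pose line a x := p x + a * (p' x - p x).
pose P x : {poly K} := (p x)%:P + 'X * (p' x - p x)%:P.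
have PE a x : horner_eval a (P x) = line a x.
  by rewrite /horner_eval !hornerE.
have horner_surj a y : exists x, horner_eval a x = y :> K.
  by exists y%:P; rewrite /horner_eval hornerC.
have good (ws' : seq W) : (forall w', w' \in ws' -> exists a,
      nil_at (fun r e i j => line a (sigma w' r e i j)) q) ->
    exists2 delta : {poly K}, delta != 0 & forall a, delta.[a] != 0 ->
      forall w', w' \in ws' -> nil_at (fun r e i j => line a (sigma w' r e i j)) q.
  elim: ws' => [|w1 ws' IHws'] nilw'; first by exists 1; rewrite ?oner_neq0.
  have [|delta' delta'_neq0 nil'] := IHws'.
    by move=> w' w'ws; apply: nilw'; rewrite inE w'ws orbT.
  have [a0 nila0] := nilw' w1 (mem_head _ _).
  have /(nil_at_specialize (horner_surj a0))[delta [delta_neq0 nild]] :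
      nil_at (fun r e i j => horner_eval a0 (P (sigma w1 r e i j))) q.
    by apply: eq_nil_at nila0 => r e i j; rewrite PE.
  have {}delta_neq0 : delta != 0.
    by apply: contraNneq delta_neq0 => ->; rewrite rmorph0.
  exists (delta * delta'); first by rewrite mulf_neq0.
  move=> a; rewrite hornerM mulf_eq0 negb_or => /andP[nza /nil' nila] w'.
  rewrite inE => /predU1P[->|/nila//].
  have /eq_nil_at : nil_at (fun r e i j => horner_eval a (P (sigma w1 r e i j))) q.
    exact: (nild _ (horner_eval a)).
  by apply=> r e i j; rewrite PE.
have [w'|delta delta_neq0 nild] := good (w :: ws).
  rewrite inE => /predU1P[->|w'ws].
    by exists 1; apply: eq_nil_at nilp' => r e i j; rewrite /line mul1r addrC subrK.
  exists 0; apply: eq_nil_at (nilp w' w'ws) => r e i j.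
  by rewrite /line mul0r addr0.
have [a /nild nila] := infinite_nonroot K_inf delta_neq0.
by exists (line a).
Qed.

(** * Degree 4: generic relations between blocks of letters *)

Lemma unsorted_split (T : eqType) (e : rel T) (s : seq T) : ~~ sorted e s ->
  exists u x y v, s = u ++ [:: x, y & v] /\ ~~ e x y.
Proof.
case: s => // x s /=; elim: s x => //= y s IHs x.
rewrite negb_and => /orP[exy|/IHs[u [x' [y' [v [-> exy]]]]]].
  by exists [::], x, y, s.
by exists (x :: u), x', y', v.
Qed.

(** Products of two letters of one block are relations, so only words whose
    consecutive letters lie in distinct blocks matter; for a given sequence s of
    blocks, t is a function on words in V. *)
Lemma nilpotent_blocks (K : fieldType) (V F : finType) m q
    (c : 'I_m -> 'I_m -> F -> V -> V -> K) :
    (forall i0 s, size s = q.+1 -> sorted (fun i j => i != j) s ->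
       nil_at (fun r => c (nth i0 s r) (nth i0 s r.+1)) q.+1) ->
  nilpotent K q.+1 (m * #|V|) (m ^ 2 * #|F| + m * #|V| ^ 2).
Proof.
move=> nilc.
pose c' (e : 'I_m * 'I_m * F + 'I_m * (V * V)) (x y : 'I_m * V) : K :=
  match e with
  | inl (i, j, k) => ((x.1 == i) && (y.1 == j))%:R * c i j k x.2 y.2
  | inr (i, (a, b)) => ((x == (i, a)) && (y == (i, b)))%:R
  end.
have <- : #|{: 'I_m * V}| = (m * #|V|)%N by rewrite card_prod !card_ord.
apply: (nilpotent_card (c := c')).
  by rewrite !(card_sum, card_prod) !card_ord !mulnn.
apply/nil_at_kills => t kt w wq.
have [s_w|] := boolP (sorted (fun i j => i != j) (unzip1 w)); last first.
  move=> /unsorted_split[u [i [j [v [wE /negPn/eqP ij]]]]].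
  have [|u' [[i1 a] [[j1 b] [v' [wE' u'u _]]]]] := @split2 _ w (size u) (size v).
    by have := congr1 size wE; rewrite size_map size_cat /= !addnS.
  move: wE; rewrite wE' /unzip1 map_cat => /eqP; rewrite eqseq_cat ?size_map //= !eqseq_cons.
  case/and4P => _ /eqP-> /eqP-> _; rewrite ij.
  by rewrite -[RHS](kt u' (inr (j, (a, b))) v') sum2_delta.
have [i0 _] : {i0 : 'I_m & true} by case: (w) wq => // -[i a] _ _; exists i.
rewrite -[w]zip_unzip.
have wq1 : size (unzip1 w) = q.+1 by rewrite size_map.
have wq2 : size (unzip2 w) = q.+1 by rewrite size_map.
move: (unzip1 w) (unzip2 w) s_w wq1 wq2 => s y s_sorted sq yq {w wq}.
apply: (nilc i0 s sq s_sorted (fun y => t (zip s y))) => // {y yq} u e v uvq.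
have [|s1 [i [j [s2 [sE s1u s2v]]]]] := @split2 _ s (size u) (size v).
  by rewrite sq.
rewrite -[RHS](kt (zip s1 u) (inl (i, j, e)) (zip s2 v)) [RHS]sum_pair [RHS]exchange_big /=.
apply: eq_bigr => a _; under [RHS]eq_bigr => i' _ do rewrite sum_pair exchange_big.
rewrite [RHS]exchange_big /=; apply: eq_bigr => b _.
under [RHS]eq_bigr => i' _ do under eq_bigr => j' _ do rewrite -mulrA.
rewrite (sum2_delta i j (fun i' j' =>
  c i j e a b * t (zip s1 u ++ [:: (i', a), (j', b) & zip s2 v]))).
by rewrite sE zip_cat // -s1u !nth_cat ltnn ltnNge leqnSn /= subnn subSnn.
Qed.

(** The relations of the outer pairs determine t(x, y) from its values for y in A,
    and also from its values for x in A: here inl is A and inr is B. *)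
Lemma nil_at_alternating (K : fieldType) a b d : (a ^ 2 <= d)%N -> ((a + b) * b <= d)%N ->
  exists outer inner : 'I_d -> 'I_a + 'I_b -> 'I_a + 'I_b -> K,
    nil_at (fun r => if r == 1%N then inner else outer) 4.
Proof.
move=> aad abd; set V : finType := ('I_a + 'I_b)%type.
pose outer (k : 'I_d) (x y : V) : K :=
  match slot (V * 'I_b)%type k with
  | Some (inl i, j) => ((x == inl i) && (y == inr j))%:R -
                       ((x == inr j) && (y == inl i))%:R
  | Some (inr i, j) => ((x == inr i) && (y == inr j))%:R
  | None => 0
  end.
pose inner (k : 'I_d) (x y : V) : K :=
  if slot ('I_a * 'I_a)%type k is Some (i, j) then
    ((x == inl i) && (y == inl j))%:R else 0.
exists outer, inner => t ann.
have inner0 x i j y : t [:: x; inl i; inl j; y] = 0.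
  have eP : (enum_rank (i, j) < d)%N.
    by apply: leq_trans aad; rewrite -mulnn -[X in (_ < X * X)%N]card_ord -card_prod.
  rewrite -[RHS](ann [:: x] (Ordinal eP) [:: y] erefl) /= /inner.
  under [RHS]eq_bigr => i' _ do under eq_bigr => j' _ do rewrite /= slotP.
  by rewrite sum2_delta.
have outerP (g : V -> V -> K) : (forall k, \sum_x \sum_y outer k x y * g x y = 0) ->
    (forall i j, g (inl i) (inr j) = g (inr j) (inl i)) /\
    (forall i j, g (inr i) (inr j) = 0).
  move=> kg.
  have {}kg (x : V) (j : 'I_b) : \sum_x' \sum_y
      (match x with
       | inl i => ((x' == inl i) && (y == inr j))%:R - ((x' == inr j) && (y == inl i))%:R
       | inr i => ((x' == inr i) && (y == inr j))%:R
       end) * g x' y = 0.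
    have eP : (enum_rank (x, j) < d)%N.
      apply: leq_trans abd.
      by rewrite -[in X in (_ < X)%N](card_ord a) -[X in (_ < (_ + X) * X)%N](card_ord b)
        -card_sum -card_prod.
    rewrite -[RHS](kg (Ordinal eP)); apply: eq_bigr => x' _; apply: eq_bigr => y _.
    by rewrite /outer /= slotP; case: (x).
  split=> [i j|i j]; last by rewrite -[RHS](kg (inr i) j) sum2_delta.
  apply/eqP; rewrite -subr_eq0; apply/eqP; rewrite -[RHS](kg (inl i) j).
  under [RHS]eq_bigr => x' _ do under eq_bigr => y _ do rewrite mulrBl.
  under [RHS]eq_bigr => x' _ do rewrite sumrB.
  by rewrite sumrB !sum2_delta.
have t_inl x i y z : t [:: x; inl i; y; z] = 0.
  have [k|sym diag] := outerP (fun y z => t [:: x; inl i; y; z]).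
    exact: (ann [:: x; inl i] k [::] erefl).
  by case: y z => [j|j] [k|k] //; rewrite -sym.
case=> // x [|y [|z [|w [|]]]] // _.
have [k|sym diag] := outerP (fun x y => t [:: x; y; z; w]).
  exact: (ann [::] k [:: z; w] erefl).
by case: y x => [j|j] [k|k] //; rewrite sym.
Qed.

(** For one sequence i, j, k, l of blocks, the relations of the pair j, k are the
    inner ones and all others the outer ones; a generic choice of relations then
    serves all sequences. *)
Lemma nilpotent4 (K : fieldType) a b d m : infinite_set [set: K] ->
  (a ^ 2 <= d)%N -> ((a + b) * b <= d)%N ->
  nilpotent K 4 (m * (a + b)) (m ^ 2 * d + m * (a + b) ^ 2).
Proof.
move=> K_inf aad abd; have [outer [inner nil_alt]] := nil_at_alternating K aad abd.
set V : finType := ('I_a + 'I_b)%type in outer inner nil_alt *.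
have VE : #|V| = (a + b)%N by rewrite card_sum !card_ord.
pose W : finType := ('I_m * 4.-tuple 'I_m)%type.
pose pairs (w : W) r (e : 'I_d) (x y : V) := (nth w.1 w.2 r, nth w.1 w.2 r.+1, e, x, y).
have [w|p nilp] := @nil_at_generic K V _ _ _ pairs 4
    [seq w : W <- enum W | sorted (fun i j => i != j) (tval w.2)] K_inf.
  rewrite mem_filter => /andP[]; case: w => i0 [[//|i [//|j [//|k [//|l [|//]]]]] s4] /=.
  case/and4P=> ij jk kl _ _.
  (* the pair j, k differs from i, j and k, l because neighbouring blocks differ *)
  exists (fun x => let: (i', j', e, y, z) := x in
    if (i' == j) && (j' == k) then inner e y z else outer e y z).
  move=> t ann w w4; apply: (nil_alt t) => // u e v uv4.
  rewrite -[RHS](ann u e v uv4); apply: eq_bigr => x _; apply: eq_bigr => y _.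
  congr (_ * _); rewrite /pairs /=.
  case: (size u) uv4 => [|[|[|n]]] //= _.
  - by rewrite (negPf ij).
  - by rewrite !eqxx.
  - by rewrite [k == j]eq_sym (negPf jk).
have := @nilpotent_blocks K V 'I_d m 3 (fun i j e x y => p (i, j, e, x, y)).
rewrite VE card_ord; apply=> i0 s s4 s_sorted.
have s4' : size s == 4 by rewrite s4.
apply: (nilp (i0, Tuple s4')).
by rewrite mem_filter /= s_sorted mem_enum.
Qed.

(** * Degrees 5 and 6: verified elimination *)

Definition word := seq nat.
Definition form := seq (int * word).
(** An entry (w, f) of a table says that w equals the combination f. *)
Definition table := seq (word * form).
Definition relations := seq (seq (int * (nat * nat))).

(* Comparison of words by plain recursion keeps the evaluation fast. *)
Fixpoint eqw (u v : word) : bool :=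
  match u, v with
  | [::], [::] => true
  | i :: u', j :: v' => eqn i j && eqw u' v'
  | _, _ => false
  end.

Lemma eqwP u v : reflect (u = v) (eqw u v).
Proof.
elim: u v => [|i u IHu] [|j v] /=; try by constructor.
by apply: (iffP andP) => [[/eqnP-> /IHu->]|[-> uv]] //; split; [exact/eqnP | exact/IHu].
Qed.

Fixpoint ltw (u v : word) : bool :=
  match u, v with
  | i :: u', j :: v' => (i < j)%N || (eqn i j && ltw u' v')
  | _, _ => false
  end.

Definition lookup (tab : table) (w : word) : form :=
  if [seq y <- tab | eqw y.1 w] is y :: _ then y.2 else [:: (1, w)].

Definition coef_of (w : word) (f : form) : int :=
  if [seq x <- f | eqw x.2 w] is x :: _ then x.1 else 0.

(** Any entry could serve as pivot; choosing the greatest word among those with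
    an invertible coefficient keeps the combinations short. *)
Definition pivot (f : form) : option (int * word) :=
  foldr (fun x best =>
    if (x.1 == 1) || (x.1 == -1) then
      if best is Some y then if ltw y.2 x.2 then Some x else best else Some x
    else best) None f.

(** The words that the combinations of the table still involve. *)
Definition normals (tab : table) : seq word :=
  foldr (fun w ws => if has (eqw w) ws then ws else w :: ws) [::]
    (flatten [seq [seq x.2 | x <- y.2] | y <- tab]).

Section Elimination.
(** Coefficients are reduced modulo p; for p = 0 this does nothing. *)
Variable p : int.

Fixpoint add_term (a : int) (w : word) (f : form) : form :=
  if f is (b, w') :: f' then
    if eqw w w' then let c := ((a + b) %% p)%Z in
      if c == 0 then f' else (c, w) :: f'
    else (b, w') :: add_term a w f'
  else let c := (a %% p)%Z in if c == 0 then [::] else [:: (c, w)].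

Definition add_form (a : int) (f g : form) : form :=
  foldr (fun x h => add_term (a * x.1) x.2 h) g f.

Definition reduce (tab : table) (f : form) : form :=
  foldr (fun x g => add_form x.1 (lookup tab x.2) g) [::] f.

Definition eliminate (tab : table) (f : form) : table :=
  let g := reduce tab f in
  if pivot g is Some (b, w) then
    [seq (let a := coef_of w y.2 in
          if a == 0 then y else (y.1, add_form (- (b * a)) g y.2)) | y <- tab]
  else tab.

(** The relation r placed after the prefix w, with its first letter absorbed into
    the prefix by the table of the previous degree. *)
Definition relation_row (tab : table) (w : word) (r : seq (int * (nat * nat))) : form :=
  foldr (fun x g =>
    add_form x.1 [seq (y.1, rcons y.2 x.2.2) | y <- lookup tab (rcons w x.2.1)] g)
  [::] r.

(** A state consists of the normal words one degree below and the table of the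
    current degree, whose keys are the normal words of the degree below followed
    by one letter. *)
Definition next_degree (n : nat) (rels : relations) (s : seq word * table) :
    seq word * table :=
  let ws := normals s.2 in
  (ws, foldl eliminate
         [seq (w, [:: (1, w)]) | w <- [seq rcons w i | w <- ws, i <- iota 0 n]]
         [seq relation_row s.2 w r | w <- s.1, r <- rels]).

Definition degree_state n rels q : seq word * table :=
  iter q (next_degree n rels) ([::], [:: ([::], [:: (1, [::])])]).

Definition nil_check n rels q : bool := nilp (normals (degree_state n rels q).2).

Variable K : comNzRingType.
Hypothesis pK : p%:~R = 0 :> K.

Definition eval (t : word -> K) (f : form) : K := \sum_(x <- f) x.1%:~R * t x.2.

Lemma eval_cons t x f : eval t (x :: f) = x.1%:~R * t x.2 + eval t f.
Proof. by rewrite /eval big_cons. Qed.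

Lemma eval_nil t : eval t [::] = 0.
Proof. by rewrite /eval big_nil. Qed.

Lemma modzK a : (a %% p)%Z%:~R = a%:~R :> K.
Proof. by rewrite [in RHS](divz_eq a p) [RHS]intrD intrM pK mulr0 add0r. Qed.

Lemma eval_add_term t a w f :
  eval t (add_term a w f) = a%:~R * t w + eval t f.
Proof.
elim: f => [|[b w'] f IHf] /=.
  rewrite eval_nil addr0 -(modzK a); case: eqP => [->|_]; rewrite ?eval_cons eval_nil.
    by rewrite mul0r.
  by rewrite addr0.
rewrite eval_cons; case: eqwP => [->|_] /=; last by rewrite eval_cons IHf addrCA.
rewrite addrA -mulrDl -intrD -(modzK (a + b)).
by case: eqP => [->|_]; rewrite ?mul0r ?add0r // eval_cons.
Qed.

Lemma eval_add_form t a f g : eval t (add_form a f g) = a%:~R * eval t f + eval t g.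
Proof.
elim: f => [|x f IHf] /=; first by rewrite eval_nil mulr0 add0r.
by rewrite eval_add_term IHf eval_cons mulrDr addrA intrM mulrA.
Qed.

Definition valid (t : word -> K) (tab : table) : Prop :=
  forall y, y \in tab -> t y.1 = eval t y.2.

Lemma eval_lookup t tab w : valid t tab -> eval t (lookup tab w) = t w.
Proof.
move=> tabP; rewrite /lookup.
have : forall y, y \in [seq y <- tab | eqw y.1 w] -> t w = eval t y.2.
  by move=> y; rewrite mem_filter => /andP[/eqwP<- /tabP].
case: [seq y <- tab | _] => [_|y s /(_ _ (mem_head _ _))//].
by rewrite eval_cons eval_nil mul1r addr0.
Qed.

Lemma eval_reduce t tab f : valid t tab -> eval t (reduce tab f) = eval t f.
Proof.
move=> tabP; elim: f => //= x f IHf.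
by rewrite eval_add_form IHf eval_lookup // eval_cons.
Qed.

Lemma valid_eliminate t tab f : eval t f = 0 -> valid t tab -> valid t (eliminate tab f).
Proof.
move=> f0 tabP; rewrite /eliminate; case: pivot => // -[b w] _ /mapP[y ytab ->].
case: ifP => _ /=; first exact: tabP.
by rewrite eval_add_form eval_reduce // f0 mulr0 add0r; apply: tabP.
Qed.

Lemma keys_eliminate tab f : map fst (eliminate tab f) = map fst tab.
Proof.
rewrite /eliminate; case: pivot => // -[b w]; rewrite -map_comp.
by apply: eq_map => y /=; case: ifP.
Qed.

Lemma mem_normals (tab : table) y x : y \in tab -> x \in y.2 -> x.2 \in normals tab.
Proof.
move=> ytab xy; have : x.2 \in flatten [seq [seq x.2 | x <- y.2] | y <- tab].
  by apply/flattenP; exists (map snd y.2); apply: map_f.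
rewrite /normals; elim: (flatten _) => //= w ws IHws.
rewrite inE => /predU1P[->|/IHws xws].
  by case: hasP => [[w' w'ws /eqwP->]|_]; rewrite ?mem_head.
by case: ifP; rewrite // inE xws orbT.
Qed.

Variables (n : nat) (rels : relations).

Definition solves (t : word -> K) : Prop :=
  forall u r v, r \in rels ->
    \sum_(x <- r) x.1%:~R * t (u ++ [:: x.2.1, x.2.2 & v]) = 0.

Lemma solves_rcons t i : solves t -> solves (fun w => t (rcons w i)).
Proof.
move=> tP u r v rr; rewrite -[RHS](tP u r (rcons v i) rr).
by apply: eq_bigr => x _; rewrite rcons_cat.
Qed.

(** With its last letter fixed, a solution is again a solution: the table of
    degree q applies to the prefixes of words of degree q + 1. *)
Lemma valid_degree_state q t : solves t -> valid t (degree_state n rels q).2.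
Proof.
elim: q t => [|q IHq] t tP.
  by move=> y; rewrite inE => /eqP-> /=; rewrite eval_cons eval_nil mul1r addr0.
rewrite /degree_state iterS -/(degree_state n rels q) /=.
set tab0 := [seq (w, _) | w <- _].
have : valid t tab0.
  by move=> y /mapP[w _ ->] /=; rewrite eval_cons eval_nil mul1r addr0.
have : forall f, f \in [seq relation_row (degree_state n rels q).2 w r
         | w <- (degree_state n rels q).1, r <- rels] -> eval t f = 0.
  move=> f /allpairsP[[w r] [_ rr ->]] /=.
  rewrite -[RHS](tP w r [::] rr) /relation_row.
  elim: (r) => [|x r' IHr] /=; first by rewrite eval_nil big_nil.
  rewrite eval_add_form IHr big_cons; congr (_ * _ + _).
  have := eval_lookup (rcons w x.2.1) (IHq _ (solves_rcons x.2.2 tP)).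
  rewrite -cats1 rcons_cat /= => <-.
  by rewrite /eval big_map.
elim: [seq _ | w <- _, r <- _] tab0 => [|f fs IHfs] tab0 f0 tabP //=.
apply: IHfs; first by move=> g gfs; apply: f0; rewrite inE gfs orbT.
by apply: valid_eliminate => //; apply: f0; apply: mem_head.
Qed.

(** A solution is determined by its values on the normal words. *)
Lemma degree_state_span q t : solves t ->
    (forall w, w \in normals (degree_state n rels q).2 -> t w = 0) ->
  forall w, size w = q -> all (fun i => i < n)%N w -> t w = 0.
Proof.
elim: q t => [|q IHq] t tP t0 w.
  by move=> /size0nil-> _; apply: t0; rewrite inE.
case/lastP: w => // w i; rewrite size_rcons all_rcons => -[wq] /andP[i_lt w_lt].
apply: (IHq (fun w => t (rcons w i))) => //; first exact: solves_rcons.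
move=> {wq w_lt}w wN.
have : rcons w i \in map fst (degree_state n rels q.+1).2.
  rewrite /degree_state iterS -/(degree_state n rels q) /=.
  set tab0 := [seq (w, _) | w <- _].
  have : rcons w i \in map fst tab0.
    rewrite -map_comp map_id_in //; apply/allpairsP; exists (w, i); split=> //.
    by rewrite mem_iota.
  elim: [seq _ | w <- _, r <- _] tab0 => [|f fs IHfs] tab0 //=.
  by move=> wi_tab; apply: IHfs; rewrite keys_eliminate.
case/mapP => y ytab ->; rewrite (valid_degree_state tP ytab).
rewrite /eval big_seq big1 // => x xy.
by rewrite t0 ?mulr0 //; apply: mem_normals xy.
Qed.

Lemma nil_checkP q t : nil_check n rels q -> solves t ->
  forall w, size w = q -> all (fun i => i < n)%N w -> t w = 0.
Proof. by move=> /nilP chk tP; apply: degree_state_span => //; rewrite chk. Qed.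
End Elimination.

Definition relation_coef n d (rels : relations) (e : 'I_d) (i j : 'I_n) : int :=
  \sum_(x <- nth [::] rels e | x.2 == (val i, val j)) x.1.

Definition well_formed n (rels : relations) : bool :=
  all (all (fun x : int * (nat * nat) => (x.2.1 < n)%N && (x.2.2 < n)%N)) rels.

Lemma nil_at_check (K : comNzRingType) p n rels q :
    p%:~R = 0 :> K -> well_formed n.+1 rels -> nil_check p n.+1 rels q ->
  nil_at (fun=> fun (e : 'I_(size rels)) (i j : 'I_n.+1) =>
            (relation_coef rels e i j)%:~R : K) q.
Proof.
move=> pK /allP wf chk; apply/nil_at_kills => t kt w wq.
have -> : w = map inord (map val w).
  by rewrite -map_comp map_id_in // => i _ /=; rewrite inord_val.
apply: (nil_checkP pK chk (t := t \o map inord)); last 2 first.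
- by rewrite size_map.
- by apply/allP => i /mapP[j _ ->]; apply: ltn_ord.
move=> u r v rr.
have rP : (index r rels < size rels)%N by rewrite index_mem.
rewrite -[RHS](kt (map inord u) (Ordinal rP) (map inord v)).
under [RHS]eq_bigr => i _ do under eq_bigr => j _ do
  rewrite /relation_coef /= nth_index // big_mkcond rmorph_sum mulr_suml.
under [RHS]eq_bigr => i _ do rewrite exchange_big.
rewrite [RHS]exchange_big; apply: eq_big_seq => x xr.
have /andP[x1 x2] := allP (wf _ rr) _ xr.
rewrite /= map_cat /= -(sum2_delta (inord x.2.1) (inord x.2.2) (fun i j : 'I_n.+1 =>
  x.1%:~R * t (map inord u ++ [:: i, j & map inord v]))).
apply: eq_bigr => i _; apply: eq_bigr => j _.
have -> : (x.2 == (val i, val j)) = (i == inord x.2.1) && (j == inord x.2.2).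
  case: (x.2) x1 x2 => a b /= a_lt b_lt.
  by rewrite xpair_eqE -!val_eqE /= !inordK // ![_ == val _]eq_sym.
by case: ifP => _; rewrite ?mul1r ?mul0r.
Qed.

Definition relations_3_3 : relations :=
  [:: [:: (Posz 1, (1, 0)%N); (Posz 1, (1, 2)%N)];
      [:: (Posz 1, (0, 0)%N); (Negz 0, (2, 2)%N); (Posz 1, (1, 1)%N)];
      [:: (Posz 1, (0, 1)%N); (Posz 1, (0, 2)%N)]].

Definition relations_4_5 : relations :=
  map (map (fun x => (Posz 1, x)))
    [:: [:: (0, 3); (0, 0); (1, 1)]; [:: (0, 2); (0, 0)];
        [:: (2, 1); (1, 0); (3, 2)]; [:: (1, 3); (2, 2)];
        [:: (3, 3); (1, 2); (0, 3)]]%N.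

(** The relations are yx + yz, xx + yy - zz and xy + xz, for the letters x, y, z;
    with these signs the elimination over the integers never runs out of pivots
    equal to 1 or -1. *)
Lemma nilpotent5 (K : fieldType) : nilpotent K 5 3 3.
Proof.
exists (fun e i j => (relation_coef relations_3_3 e i j)%:~R).
by apply: (@nil_at_check K 0 2 relations_3_3) => //; vm_compute.
Qed.

(** Over the integers the elimination would need other pivots and large
    coefficients, hence the detour through the field with 2 elements. *)
Lemma nilpotent6 (K : fieldType) : [pchar K] =i pred0 -> nilpotent K 6 4 5.
Proof.
move=> K0; exists (fun e i j => (relation_coef relations_4_5 e i j)%:~R).
have nil2 : nil_at (fun=> fun (e : 'I_5) (i j : 'I_4) =>
    (relation_coef relations_4_5 e i j)%:~R : 'F_2) 6.
  by apply: (@nil_at_check 'F_2 2 3 relations_4_5); [apply/eqP | | vm_compute].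
have intr2_surj (y : 'F_2) : exists x : int, x%:~R = y.
  by exists (val y)%:Z; rewrite -pmulrn natr_Zp.
have [delta [delta2 nild]] := nil_at_specialize intr2_surj nil2.
apply: (nild K intr).
have : delta != 0 by apply: contraNneq delta2 => ->; rewrite rmorph0.
have K0P := (pcharf0P K).1 K0.
case: delta {delta2 nild} => n n_neq0.
  by change (n%:R != 0 :> K); rewrite K0P.
by rewrite NegzE rmorphN oppr_eq0; change (n.+1%:R != 0 :> K); rewrite K0P.
Qed.

(** * The Golod-Shafarevich inequality *)

Section GolodShafarevich.
Variables (K : fieldType) (n d : nat) (c : 'I_d -> 'I_n -> 'I_n -> K).

(** The dimension count runs over such families: the b of one length, independent
    solutions, serve as the e of the next length, where they carry the solutions
    left after the first letter is removed. *)
Definition solution_family (k m l : nat) : Prop :=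
  exists (b : 'I_m -> seq 'I_n -> K) (e : 'I_l -> seq 'I_n -> K),
  [/\ forall j, kills c (b j),
      forall j w, size w != k -> b j w = 0,
      forall a : 'I_m -> K, (forall w, \sum_j a j * b j w = 0) -> forall j, a j = 0
    & forall j y, exists beta : 'I_l -> K,
        forall w, b j (y :: w) = \sum_s beta s * e s w].

Lemma solution_family1 : solution_family 1 n 1.
Proof.
exists (fun y w => (w == [:: y])%:R), (fun _ w => (w == [::])%:R); split.
- move=> y u e v; rewrite big1 // => i _; rewrite big1 // => j _.
  case: eqP => [uv|_]; last by rewrite mulr0.
  by have := congr1 size uv; rewrite size_cat /= !addnS.
- by move=> y [|x [|x1 w]] //= _; rewrite eqseq_cons andbF.
- move=> a a0 j; rewrite -[RHS](a0 [:: j]) (bigD1 j) //= eqxx mulr1 big1 ?addr0 //.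
  by move=> i /negPf ij; rewrite eqseq_cons eq_sym ij mulr0.
- move=> j y; exists (fun=> (y == j)%:R) => w.
  by rewrite big_ord1 eqseq_cons -natrM mulnb.
Qed.

(** A function on words of length k + 1 is given by n combinations of the b j, one
    for each first letter, that is by a vector of size n m.  It is killed by the
    relations when this vector satisfies the d l equations saying that each
    relation, applied to the first two letters, gives 0 in the span of the e s. *)
Lemma solution_family_step k m l : solution_family k m l ->
  exists m', solution_family k.+1 m' m /\ (n * m <= m' + d * l)%N.
Proof.
case=> b [e [b_kills b_supp b_free]] b_shift.
have [beta betaP] : exists beta : 'I_m -> 'I_n -> 'I_l -> K,
    forall j y w, b j (y :: w) = \sum_s beta j y s * e s w.
  have [f fP] := choice (fun jy : 'I_m * 'I_n => b_shift jy.1 jy.2).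
  by exists (fun j y => f (j, y)) => j y; exact: (fP (j, y)).
pose M : 'M[K]_(#|{: 'I_n * 'I_m}|, #|{: 'I_d * 'I_l}|) :=
  \matrix_(i, j) let x : 'I_n * 'I_m := enum_val i in let r : 'I_d * 'I_l := enum_val j in
    \sum_y c r.1 x.1 y * beta x.2 y r.2.
pose B := row_base (kermx M).
pose Bc r (x : 'I_n) (j : 'I_m) := B r (enum_rank (x, j)).
have BM r (i : 'I_d) (s : 'I_l) :
    \sum_x \sum_j Bc r x j * (\sum_y c i x y * beta j y s) = 0.
  have /matrixP/(_ r (enum_rank (i, s))) : B *m M = 0.
    by apply/sub_kermxP; rewrite eq_row_base.
  rewrite !mxE => BM0; rewrite -[RHS]BM0 pair_bigA /=.
  rewrite (reindex _ (onW_bij _ (@enum_val_bij {: 'I_n * 'I_m}))) /=.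
  apply: eq_bigr => x _; rewrite [M _ _]mxE enum_rankK /Bc; case xE: (enum_val x) => [x1 x2] /=.
  by rewrite -xE enum_valK.
pose b' r (w : seq 'I_n) :=
  if w is x :: w' then \sum_j Bc r x j * b j w' else 0.
exists (\rank (kermx M)); split; last first.
  have nmE : (n * m)%N = #|{: 'I_n * 'I_m}| by rewrite card_prod !card_ord.
  have dlE : (d * l)%N = #|{: 'I_d * 'I_l}| by rewrite card_prod !card_ord.
  by rewrite mxrank_ker nmE dlE addnC -leq_subLR leq_sub2l // rank_leq_col.
exists b', b; split.
- move=> r [|x u] i v /=.
    under eq_bigr => x _ do under eq_bigr => y _ do rewrite mulr_sumr.
    under eq_bigr => x _ do rewrite exchange_big.
    transitivity (\sum_s e s v * \sum_x \sum_j Bc r x j * (\sum_y c i x y * beta j y s)).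
      under [RHS]eq_bigr => s _ do rewrite mulr_sumr.
      rewrite [RHS]exchange_big; apply: eq_bigr => x _.
      under [RHS]eq_bigr => s _ do rewrite mulr_sumr.
      rewrite [RHS]exchange_big; apply: eq_bigr => j _.
      under eq_bigr => y _ do rewrite betaP !mulr_sumr.
      rewrite exchange_big; apply: eq_bigr => s _.
      rewrite !mulr_sumr; apply: eq_bigr => y _; ring.
    by rewrite big1 // => s _; rewrite BM mulr0.
  under eq_bigr => x' _ do under eq_bigr => y _ do rewrite mulr_sumr.
  under eq_bigr => x' _ do rewrite exchange_big.
  rewrite exchange_big big1 // => j _.
  have := congr1 (fun z => Bc r x j * z) (b_kills j u i v).
  rewrite mulr0 mulr_sumr => kj; rewrite -[RHS]kj.
  apply: eq_bigr => x' _; rewrite mulr_sumr; apply: eq_bigr => y _.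
  by rewrite mulrCA.
- by move=> r [|x w] //= wk; rewrite big1 // => j _; rewrite b_supp ?mulr0.
- move=> a a0.
  have aB : (\row_r a r) *m B = 0.
    apply/rowP => x; rewrite !mxE; case xE: (enum_val x) => [y j].
    rewrite -[RHS](b_free (fun j => \sum_r a r * Bc r y j) _ j) => [|w].
      by apply: eq_bigr => r _; rewrite mxE /Bc -xE enum_valK.
    rewrite -[RHS](a0 (y :: w)) /=.
    under eq_bigr => i _ do rewrite mulr_suml.
    rewrite exchange_big; apply: eq_bigr => r _; rewrite mulr_sumr.
    by apply: eq_bigr => i _; rewrite mulrA.
  have : \row_r a r = 0.
    by apply: (row_free_inj (row_base_free (kermx M))); rewrite mul0mx.
  by move/rowP => + j => /(_ j); rewrite !mxE.
- by move=> r y; exists (Bc r y).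
Qed.

Lemma solution_family_not_nil k m l : (0 < m)%N -> solution_family k m l ->
  ~ nil_at (fun=> c) k.
Proof.
case: m => // m _ [b [e [b_kills b_supp b_free _]]] /nil_at_kills nilc.
suff /b_free/(_ ord0)/eqP : forall w, \sum_j (j == ord0)%:R * b j w = 0.
  by rewrite eqxx oner_eq0.
move=> w; rewrite big1 // => j _; have [wk|wk] := eqVneq (size w) k.
  by rewrite (nilc _ (b_kills j)) ?mulr0.
by rewrite b_supp ?mulr0.
Qed.

(** If m and l are the dimensions in lengths k + 1 and k, and m >= rho k l, then
    the next dimension is at least n m - d l >= (n - d / rho k) m. *)
Lemma golod_shafarevich (R : realFieldType) (rho : nat -> R) q :
    rho 0%N <= n%:R -> (forall k, (k <= q)%N -> 0 < rho k) ->
    (forall k, (k < q)%N -> rho k.+1 <= n%:R - d%:R / rho k) ->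
  ~ nil_at (fun=> c) q.+1.
Proof.
move=> rho0 rho_gt0 rhoS.
have n_gt0 : (0 < n)%N by rewrite -(ltr0n R) (lt_le_trans (rho_gt0 0%N _)).
suff [m [l [sf m_gt0 _]]] : exists m l,
    [/\ solution_family q.+1 m l, (0 < m)%N & rho q * l%:R <= m%:R].
  exact: solution_family_not_nil sf.
elim: q rho_gt0 rhoS => [|q IHq] rho_gt0 rhoS.
  by exists n, 1; split=> //; [exact: solution_family1 | rewrite mulr1].
have [||m [l [sf m_gt0 ml]]] := IHq.
- by move=> k kq; apply: rho_gt0; apply: leqW.
- by move=> k kq; apply: rhoS; apply: leqW.
have [m' [sf' mm']] := solution_family_step sf.
have m'_ge : rho q.+1 * m%:R <= m'%:R.
  have rq := rho_gt0 q (leqnSn q).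
  have : l%:R <= m%:R / rho q by rewrite ler_pdivlMr // mulrC.
  move: mm'; rewrite -(ler_nat R) natrD !natrM => mm' l_le.
  apply: le_trans (_ : (n%:R - d%:R / rho q) * m%:R <= _).
    by rewrite ler_wpM2r ?rhoS.
  have : d%:R * l%:R <= d%:R * (m%:R / rho q) by rewrite ler_wpM2l.
  by rewrite mulrBl; lra.
exists m', m; split=> //; rewrite -(ltr0n R) (lt_le_trans _ m'_ge) //.
by rewrite mulr_gt0 ?rho_gt0 ?ltr0n.
Qed.
End GolodShafarevich.

(** The same inequality for densities: x k is a lower bound for the quotient of
    the dimensions in lengths k + 1 and k divided by n, at the critical density
    a.  Below that density the next quotient would be positive. *)
Lemma nilpotent_ge (R : realFieldType) (K : fieldType) (a : R) (x : nat -> R) q n d :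
    (0 < n)%N -> x 0%N <= 1 -> (forall k, (k <= q)%N -> 0 < x k) ->
    (forall k, (k < q)%N -> x k.+1 <= 1 - a / x k) -> a <= x q ->
  nilpotent K q.+2 n d -> a * n%:R ^+ 2 <= d%:R.
Proof.
move=> n_gt0 x0 x_gt0 xS axq [c]; rewrite leNgt; apply: contraPN => d_lt.
have n0 : 0 < n%:R :> R by rewrite ltr0n.
pose rho k := if (k <= q)%N then n%:R * x k else n%:R - d%:R / (n%:R * x q).
have step k : (k <= q)%N -> n%:R - n%:R * (a / x k) <= n%:R - d%:R / (n%:R * x k).
  move=> kq; rewrite lerB // ler_pdivrMr ?mulr_gt0 ?x_gt0 //.
  suff -> : n%:R * (a / x k) * (n%:R * x k) = a * n%:R ^+ 2 by apply: ltW.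
  by field; rewrite gt_eqF ?x_gt0.
apply: (@golod_shafarevich K n d c R rho).
- by rewrite /rho /= ler_piMr.
- move=> k _; rewrite /rho; case: ifP => [kq|_]; first by rewrite mulr_gt0 ?x_gt0.
  have xq := x_gt0 q (leqnn q).
  rewrite subr_gt0 ltr_pdivrMr ?mulr_gt0 // mulrA -expr2.
  by apply: lt_le_trans d_lt _; rewrite mulrC ler_wpM2l ?exprn_ge0.
- move=> k; rewrite ltnS => kq; rewrite /rho kq; case: ifP => [k1q|kq'].
    apply: le_trans (step k kq); rewrite -{2}[n%:R]mulr1 -mulrBr.
    by rewrite ler_wpM2l // xS.
  by have -> : k = q by apply/eqP; rewrite eqn_leq kq leqNgt kq'.
Qed.

(** * Ideals of the free algebra *)

Section FreeAlgebra.
Variables (K : fieldType) (n : nat).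
Local Notation A := (free_alg K n).

Definition mon (w : seq 'I_n) : A := mkmalgU (FMonom w) 1.

Lemma mcoeff_mon (w : fmonom 'I_n) u : mcoeff w (mon u) = (u == w :> seq _)%:R.
Proof. by rewrite mcoeffU fmP. Qed.

Lemma mcoeff_sum_mon (I : Type) (s : seq I) (a : I -> K) (u : I -> seq 'I_n) w :
  mcoeff w (\sum_(x <- s) a x *: mon (u x)) = \sum_(x <- s) a x * (u x == w :> seq _)%:R.
Proof.
rewrite raddf_sum; apply: eq_bigr => x _.
by rewrite /= mcoeffZ mcoeff_mon.
Qed.

Lemma scale_mon b w : b *: mon w = mkmalgU (FMonom w) b.
Proof. by apply/malgP => v; rewrite mcoeffZ !mcoeffU mulr_natr. Qed.

Lemma monMZ u b v : mon u * (b *: mon v) = b *: mon (u ++ v).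
Proof.
rewrite !scale_mon malgM_def [LHS]fgmulUU mul1r; congr mkmalgU.
by rewrite -[LHS]fmK fmM.
Qed.

Lemma monM u v : mon u * mon v = mon (u ++ v).
Proof. by have := monMZ u 1 v; rewrite !scale1r. Qed.

Lemma mon_sum (f : A) :
  f = \sum_(w <- finmap.enum_fset (msupp f)) mcoeff w f *: mon w.
Proof.
rewrite [LHS]monalgE; apply: eq_bigr => w _; apply/malgP => w'.
by rewrite mcoeffZ mcoeff_mon mcoeffU mulr_natr fmP.
Qed.

Lemma scalerMr (f : A) b v : f * (b *: mon v) = b *: (f * mon v).
Proof.
rewrite [f]mon_sum !mulr_suml scaler_sumr; apply: eq_bigr => u _.
by rewrite -!scalerAl monMZ monM !scalerA mulrC.
Qed.

Definition pairing (t : seq 'I_n -> K) : A -> K := mmap idfun (fun w : fmonom 'I_n => t w).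

Lemma pairingD t : {morph pairing t : f g / f + g}.
Proof. exact: mmapD. Qed.

Lemma pairing0 t : pairing t 0 = 0.
Proof. exact: mmap0. Qed.

Lemma pairingZ t a f : pairing t (a *: f) = a * pairing t f.
Proof.
rewrite /pairing (mmapEw (msuppZ_le _ _)) mmapE big_distrr /=.
by apply: eq_bigr => w _; rewrite mcoeffZ mulrA.
Qed.

Lemma pairing_sum t (I : Type) (s : seq I) (F : I -> A) :
  pairing t (\sum_(x <- s) F x) = \sum_(x <- s) pairing t (F x).
Proof. exact: (big_morph _ (pairingD t) (pairing0 t)). Qed.

Lemma pairing_mon t w : pairing t (mon w) = t w.
Proof. by rewrite /pairing mmapU mul1r. Qed.

Lemma pairing_monl t u f : pairing t (mon u * f) = pairing (fun w => t (u ++ w)) f.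
Proof.
rewrite [f]mon_sum mulr_sumr !pairing_sum; apply: eq_bigr => w _.
by rewrite monMZ !pairingZ !pairing_mon.
Qed.

Lemma pairing_monr t u f : pairing t (f * mon u) = pairing (fun w => t (w ++ u)) f.
Proof.
rewrite [f]mon_sum mulr_suml !pairing_sum; apply: eq_bigr => w _.
by rewrite -scalerAl !pairingZ monM !pairing_mon.
Qed.

Lemma homog_mon w : homog (size w) (mon w).
Proof. by move=> v; rewrite mcoeff_mon; case: (w =P v :> seq _) => [->|]; rewrite ?eqxx. Qed.

Definition quad_coef d (r : 'I_d -> A) (k : 'I_d) (i j : 'I_n) : K :=
  mcoeff (FMonom [:: i; j]) (r k).

Lemma homog2E (f : A) : homog 2 f ->
  f = \sum_i \sum_j mcoeff (FMonom [:: i; j]) f *: mon [:: i; j].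
Proof.
move=> f2; apply/malgP => w; rewrite pair_bigA mcoeff_sum_mon.
have [[i [j ij]]|nw] := pselect (exists i j, w = [:: i; j] :> seq _).
  rewrite (bigD1 (i, j)) //= ij eqxx mulr1 big1 ?addr0 => [|[i' j'] /= ne].
    by congr mcoeff; rewrite -ij fmK.
  by move: ne; rewrite xpair_eqE !eqseq_cons andbT => /negPf->; rewrite mulr0.
rewrite big1 => [|[i j] _] /=; last first.
  by case: eqP => [ij|]; rewrite ?mulr0 //; case: nw; exists i, j.
apply/eqP; apply: contra_notT nw => /f2; rewrite fdegE.
by case: (val w) => [|i [|j [|]]] // _; exists i, j.
Qed.

(** The elements on which all functions killed by the relations vanish form a
    two-sided ideal containing the relations. *)
Lemma quadratic_nil_at d (r : 'I_d -> A) q : quadratic_relations r ->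
  quot_dim (ideal_gen (range r)) q 0 -> nil_at (fun=> quad_coef r) q.
Proof.
move=> [r2 _] [u [_ _ uI]]; apply/nil_at_kills => t kt w wq.
have /uI[a] : homog q (mon w) by rewrite -wq; exact: homog_mon.
rewrite big_ord0 subr0 => {a}wI.
pose J : set A := [set f | forall t, kills (quad_coef r) t -> pairing t f = 0].
suff /(_ _ wI)/(_ t kt) : ideal_gen (range r) `<=` J by rewrite pairing_mon.
apply: smallest_sub => [|_ [k _ <-] t' kt'].
  split=> [t' _|f g fJ gJ t' kt'|a f fJ t' kt'|f b fJ t' kt'].
  - exact: pairing0.
  - by rewrite pairingD fJ ?gJ ?addr0.
  - rewrite [a]mon_sum mulr_suml pairing_sum big1 // => v _.
    rewrite -scalerAl pairingZ pairing_monl fJ ?mulr0 //.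
    move=> u' e v'; rewrite -[RHS](kt' (v ++ u') e v').
    by under [RHS]eq_bigr do under eq_bigr do rewrite -catA.
  - rewrite [b]mon_sum mulr_sumr pairing_sum big1 // => v _.
    rewrite scalerMr pairingZ pairing_monr fJ ?mulr0 //.
    move=> u' e v'; rewrite -[RHS](kt' u' e (v' ++ v)).
    by under [LHS]eq_bigr do under eq_bigr do rewrite -catA.
rewrite (homog2E (r2 k)) pairing_sum -[RHS](kt' [::] k [::]); apply: eq_bigr => i _.
by rewrite pairing_sum; apply: eq_bigr => j _; rewrite pairingZ pairing_mon.
Qed.
End FreeAlgebra.

(** A subspace given by a predicate is the row space of a matrix of maximal rank
    among those with rows in it. *)
Lemma linear_set_mx (K : fieldType) N (U : set 'rV[K]_N) :
    U 0 -> (forall v w, U v -> U w -> U (v + w)) -> (forall a v, U v -> U (a *: v)) ->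
  exists B : 'M[K]_N, forall v, U v <-> (v <= B)%MS.
Proof.
move=> U0 UD UZ.
pose P r := exists B : 'M[K]_N, (forall i, U (row i B)) /\ \rank B = r.
have sumU (I : Type) (s : seq I) (F : I -> 'rV[K]_N) :
    (forall i, U (F i)) -> U (\sum_(i <- s) F i).
  by move=> UF; apply: big_ind.
have subU m (B : 'M[K]_(m, N)) v : (forall i, U (row i B)) -> (v <= B)%MS -> U v.
  move=> UB /submxP[D ->]; rewrite mulmx_sum_row; apply: sumU => i; exact: UZ.
have exP : exists r, `[< P r >].
  exists 0%N; apply/asboolP; exists 0; rewrite mxrank0; split=> // i.
  by rewrite row0.
have ubP r : `[< P r >] -> (r <= N)%N.
  by move=> /asboolP[B [_ <-]]; apply: rank_leq_col.
have [_ /asboolP[B [UB <-]] maxB] := ex_maxnP exP ubP.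
exists B => v; split=> [Uv|]; last exact: subU.
pose C := (B + v)%MS.
have UC i : U (row i C).
  apply: (subU _ (col_mx B v)); last by rewrite -addsmxE row_sub.
  move=> j; case: (split_ordP j) => k ->; first by rewrite rowKu.
  by rewrite rowKd; have -> : row k v = v by apply/rowP => l; rewrite mxE ord1.
have rkC : (\rank C <= \rank B)%N by apply: maxB; apply/asboolP; exists C.
apply: submx_trans (addsmxSr B v) _.
by rewrite -(mxrank_leqif_sup (addsmxSl B v)).2 eqn_leq rkC mxrankS ?addsmxSl.
Qed.

Section Quotient.
Variables (K : fieldType) (n q : nat).
Local Notation A := (free_alg K n).
Local Notation N := #|{: q.-tuple 'I_n}|.

Definition row_mon (v : 'rV[K]_N) : A := \sum_a v 0 a *: mon K (tval (enum_val a)).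

Lemma row_monD v w : row_mon (v + w) = row_mon v + row_mon w.
Proof.
by rewrite /row_mon -big_split; apply: eq_bigr => a _; rewrite mxE scalerDl.
Qed.

Lemma row_monZ b v : row_mon (b *: v) = b *: row_mon v.
Proof.
by rewrite /row_mon scaler_sumr; apply: eq_bigr => a _; rewrite mxE scalerA.
Qed.

Lemma row_mon0 : row_mon 0 = 0.
Proof. by rewrite -(scale0r 0) row_monZ scale0r. Qed.

Lemma row_mon_sum (I : Type) (s : seq I) (F : I -> 'rV[K]_N) :
  row_mon (\sum_(i <- s) F i) = \sum_(i <- s) row_mon (F i).
Proof. exact: (big_morph _ row_monD row_mon0). Qed.

Lemma homog_row_mon v : homog q (row_mon v).
Proof.
move=> w; rewrite mcoeff_sum_mon; apply: contra_neq_eq => wq.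
rewrite big1 // => a _; case: eqP => [aw|]; rewrite ?mulr0 //.
by move: wq; rewrite fdegE -aw size_tuple eqxx.
Qed.

Lemma homogE (f : A) : homog q f -> exists v, f = row_mon v.
Proof.
move=> fq; exists (\row_a mcoeff (FMonom (tval (enum_val a))) f).
apply/malgP => w; rewrite mcoeff_sum_mon.
have [wq|wq] := eqVneq (size w) q.
  pose x : q.-tuple 'I_n := Tuple (introT eqP wq).
  rewrite (bigD1 (enum_rank x)) //= enum_rankK eqxx mulr1 big1 ?addr0 => [|a].
    by rewrite mxE enum_rankK /= fmK.
  by rewrite -(inj_eq enum_val_inj) enum_rankK -val_eqE /= => /negPf->; rewrite mulr0.
rewrite big1 => [|a _]; last first.
  case: eqP => [aw|]; rewrite ?mulr0 //.
  by move: wq; rewrite -aw size_tuple eqxx.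
by apply/eqP; apply: contraNT wq => /fq/eqP.
Qed.

Variables (I : set A) (I_ideal : two_sided_ideal I).

Let I_scale b f : I f -> I (b *: f).
Proof.
by case: I_ideal => _ _ Il _ /(Il (mkmalgU (@monalg.one _) b)); rewrite mul_malgC.
Qed.

Lemma ideal_mx : exists B : 'M[K]_N, forall v, I (row_mon v) <-> (v <= B)%MS.
Proof.
case: I_ideal => I0 ID _ _.
apply: (linear_set_mx (U := [set v | I (row_mon v)])) => [|v w Iv Iw|b v Iv] /=.
- by rewrite row_mon0.
- by rewrite row_monD; apply: ID.
- by rewrite row_monZ; apply: I_scale.
Qed.

Lemma quot_dim_exists : exists m, quot_dim I q m.
Proof.
have [B BP] := ideal_mx.
pose C := row_base B^C%MS.
have CE (c : 'I_(\rank B^C%MS) -> K) :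
    \sum_i c i *: row_mon (row i C) = row_mon ((\row_i c i) *m C).
  by rewrite mulmx_sum_row row_mon_sum; apply: eq_bigr => i _; rewrite row_monZ mxE.
exists (\rank B^C%MS), (fun i => row_mon (row i C)); split.
- by move=> i; apply: homog_row_mon.
- move=> c; rewrite CE => /BP cB i.
  have : ((\row_i c i) *m C <= B :&: B^C)%MS.
    by rewrite sub_capmx cB -(eq_row_base B^C%MS) submxMl.
  rewrite capmx_compl submx0 => /eqP c0.
  have /rowP/(_ i) : \row_i c i = 0.
    by apply: (row_free_inj (row_base_free B^C%MS)); rewrite c0 mul0mx.
  by rewrite !mxE.
- move=> f /homogE[v ->].
  have /sub_addsmxP[[w1 w2] /= vE] : (v <= B + B^C)%MS.
    by apply: submx_full; apply: addsmx_compl_full.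
  have /submxP[c cE] : (w2 *m B^C%MS <= C)%MS by rewrite eq_row_base submxMl.
  exists (fun i => c 0 i); rewrite CE.
  have -> : \row_i c 0 i = c by apply/rowP => i; rewrite mxE.
  rewrite -cE -scaleN1r -row_monZ -row_monD scaleN1r vE addrK.
  by apply/BP; apply: submxMl.
Qed.
End Quotient.

Lemma ideal_gen_ideal (K : fieldType) n (G : set (free_alg K n)) :
  two_sided_ideal (ideal_gen G).
Proof.
split=> [J [[]]|f g If Ig J JP|a f If J JP|f b If J JP] //.
- by case: (JP) => -[_ JD _ _] _; apply: JD; [apply: If | apply: Ig].
- by case: (JP) => -[_ _ Jl _] _; apply: Jl; apply: If.
- by case: (JP) => -[_ _ _ Jr] _; apply: Jr; apply: If.
Qed.

Section Relations.
Variables (K : fieldType) (n d : nat) (c : 'I_d -> 'I_n -> 'I_n -> K).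
Local Notation A := (free_alg K n).

Definition quadric (k : 'I_d) : A := \sum_i \sum_j c k i j *: mon K [:: i; j].

Lemma mcoeff_quadric k w : mcoeff w (quadric k) =
  \sum_i \sum_j c k i j * ([:: i; j] == w :> seq _)%:R.
Proof.
by rewrite /quadric pair_bigA mcoeff_sum_mon pair_bigA.
Qed.

Lemma quad_coef_quadric k i j : quad_coef quadric k i j = c k i j.
Proof.
rewrite /quad_coef mcoeff_quadric.
rewrite -[RHS](sum2_delta i j (fun i' j' => c k i' j')).
apply: eq_bigr => i' _; apply: eq_bigr => j' _.
by rewrite !eqseq_cons andbT mulrC.
Qed.

Lemma homog_quadric k : homog 2 (quadric k).
Proof.
move=> w; rewrite mcoeff_quadric; apply: contra_neq_eq => w2.
rewrite big1 // => i _; rewrite big1 // => j _.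
by case: eqP => [ij|]; rewrite ?mulr0 //; move: w2; rewrite fdegE -ij.
Qed.

(** Duality: a functional vanishing on the degree q part of the ideal is a
    function on words killed by the relations, hence 0. *)
Lemma ideal_gen_homog q : nil_at (fun=> c) q ->
  homog q `<=` ideal_gen (range quadric).
Proof.
move=> nilc f /homogE[v ->].
have I_ideal := ideal_gen_ideal (range quadric).
have [B BP] := ideal_mx q I_ideal; apply/BP.
rewrite submxE; apply/eqP/rowP => j; rewrite !mxE big1 // => a _.
suff -> : cokermx B a j = 0 by rewrite mulr0.
pose t := word_fun (col j (cokermx B))^T.
have tE b : t (tval (enum_val b)) = cokermx B b j by rewrite /t word_fun_tuple !mxE.
rewrite -tE; apply: nilc; last by rewrite size_tuple.
move=> u e w uwq.
pose g : A := \sum_i \sum_j c e i j *: mon K (u ++ [:: i, j & w]).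
have gE : g = mon K u * quadric e * mon K w.
  rewrite /quadric mulr_sumr mulr_suml; apply: eq_bigr => i _.
  rewrite mulr_sumr mulr_suml; apply: eq_bigr => k _.
  by rewrite monMZ -scalerAl monM -catA.
have g_I : ideal_gen (range quadric) g.
  rewrite gE; case: I_ideal => _ _ Il Ir; apply: Ir; apply: Il.
  by apply: sub_gen_smallest; exists e.
have g_homog : homog q g.
  move=> x; rewrite /g pair_bigA mcoeff_sum_mon; apply: contra_neq_eq => xq.
  rewrite big1 // => -[i k] _; case: eqP => [xE|]; rewrite ?mulr0 //.
  by move: xq; rewrite fdegE -xE size_cat /= !addnS uwq eqxx.
have [v' vE] := homogE g_homog.
have <- : pairing t g = \sum_i \sum_j c e i j * t (u ++ [:: i, j & w]).
  rewrite pairing_sum; apply: eq_bigr => i _; rewrite pairing_sum.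
  by apply: eq_bigr => k _; rewrite pairingZ pairing_mon.
have : v' *m cokermx B = 0 by apply/eqP; rewrite -submxE; apply/BP; rewrite -vE.
move/rowP/(_ j); rewrite !mxE => v'0; rewrite vE pairing_sum -[RHS]v'0.
by apply: eq_bigr => b _; rewrite pairingZ pairing_mon tE.
Qed.
End Relations.

(** A basis of the span of the given relations replaces them; it is not empty,
    since without relations the constant function 1 is killed. *)
Lemma nilpotent_algebra (K : fieldType) q n d : (0 < n)%N -> nilpotent K q n d ->
  exists d', [/\ (d' <= d)%N, (1 <= d' <= n ^ 2)%N &
    exists2 r : 'I_d' -> free_alg K n, quadratic_relations r &
      quot_dim (ideal_gen (range r)) q 0].
Proof.
move=> n_gt0 [c nilc].
pose C : 'M[K]_(d, #|{: 'I_n * 'I_n}|) :=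
  \matrix_(k, x) let y : 'I_n * 'I_n := enum_val x in c k y.1 y.2.
pose B := row_base C.
pose c' k i j := B k (enum_rank (i, j)).
have nilc' : nil_at (fun=> c') q.
  have /submxP[D CE] : (C <= B)%MS by rewrite eq_row_base.
  apply/nil_at_kills => t kt w wq; have /nil_at_kills nilc0 := nilc.
  apply: nilc0 wq => u e v.
  transitivity (\sum_k D e k * \sum_i \sum_j c' k i j * t (u ++ [:: i, j & v])).
    under [RHS]eq_bigr => k _ do rewrite mulr_sumr.
    rewrite [RHS]exchange_big; apply: eq_bigr => i _.
    under [RHS]eq_bigr => k _ do rewrite mulr_sumr.
    rewrite [RHS]exchange_big; apply: eq_bigr => j _.
    under [RHS]eq_bigr => k _ do rewrite mulrA.
    rewrite -mulr_suml; congr (_ * _).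
    have /matrixP/(_ e (enum_rank (i, j))) := CE.
    by rewrite mxE enum_rankK /= => ->; rewrite mxE.
  by rewrite big1 // => k _; rewrite kt mulr0.
have rkC_gt0 : (0 < \rank C)%N.
  rewrite lt0n; apply/eqP => rk0.
  have /nil_at_kills nilc0 := nilc'.
  have := nilc0 (fun=> 1) _ (nseq q (Ordinal n_gt0)) (size_nseq _ _).
  move=> one0; suff /eqP : (1 : K) = 0 by rewrite oner_eq0.
  apply: one0 => u e; exfalso; case: e => e; by rewrite rk0.
exists (\rank C); split; first exact: rank_leq_row.
  rewrite rkC_gt0 (leq_trans (rank_leq_col C)) // card_prod !card_ord mulnn //.
exists (quadric c').
  split=> [k|a a0 k]; first exact: homog_quadric.
  have aB : (\row_k a k) *m B = 0.
    apply/rowP => x; rewrite !mxE; case xE: (enum_val x) => [i j].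
    have := congr1 (mcoeff (FMonom [:: i; j])) (a0 : \sum_k a k *: quadric c' k = 0).
    rewrite mcoeff0 raddf_sum => aij; rewrite -[RHS]aij; apply: eq_bigr => k' _ /=.
    rewrite mcoeffZ -/(quad_coef _ k' _ _) quad_coef_quadric mxE /c'.
    by rewrite -xE enum_valK.
  have /rowP/(_ k) : \row_k a k = 0.
    by apply: (row_free_inj (row_base_free C)); rewrite aB mul0mx.
  by rewrite !mxE.
exists (fun=> 0); split=> [[]//|a _ []//|f /(ideal_gen_homog nilc')fI].
by exists (fun=> 0); rewrite big_ord0 subr0.
Qed.

(** * The numbers d(K, n, q) *)

Lemma nat_minP (P : set nat) : P !=set0 ->
  P (nat_min P) /\ (forall k, P k -> (nat_min P <= k)%N).
Proof.
move=> [k0 Pk0]; rewrite /nat_min; case: xgetP => [m _ //|noP].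
have exP : exists k, `[< P k >] by exists k0; apply/asboolP.
have [m /asboolP Pm mP] := ex_minnP exP.
by case: (noP m); split=> // k Pk; apply: mP; apply/asboolP.
Qed.

(** The minimum defining h is taken over a nonempty set: for d <= n^2 there are d
    distinct monomials of degree 2, and every quotient has a dimension. *)
Lemma h_eq0 (K : fieldType) q n d : (1 <= d <= n ^ 2)%N -> h K q n d = 0%N <->
  exists2 r : 'I_d -> free_alg K n, quadratic_relations r &
    quot_dim (ideal_gen (range r)) q 0.
Proof.
move=> /andP[_ dn].
have ne : quadratic_dims K n d q !=set0.
  have dn' : (d <= #|{: 'I_n * 'I_n}|)%N by rewrite card_prod !card_ord mulnn.
  pose x (k : 'I_d) : 'I_n * 'I_n := enum_val (widen_ord dn' k).
  pose r k := mon K [:: (x k).1; (x k).2].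
  have [m rm] := quot_dim_exists q (ideal_gen_ideal (range r)).
  exists m, r => //; split=> [k|a a0 k]; first exact: (@homog_mon K n [:: (x k).1; (x k).2]).
  have := congr1 (mcoeff (FMonom [:: (x k).1; (x k).2])) (a0 : \sum_k a k *: r k = 0).
  rewrite mcoeff0 mcoeff_sum_mon (bigD1 k) //= eqxx mulr1 big1 ?addr0 // => k' k'k.
  case: eqP => [[x1 x2]|]; rewrite ?mulr0 //.
  have : x k' = x k by rewrite [LHS]surjective_pairing x1 x2 -surjective_pairing.
  by move=> /enum_val_inj/(congr1 val)/= /val_inj k'E; rewrite k'E eqxx in k'k.
have [hP h_min] := nat_minP ne.
split=> [h0|[r rq r0]]; first by move: hP; rewrite -/(h K q n d) h0.
by apply/eqP; rewrite -leqn0; apply: h_min; exists r.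
Qed.

Definition degrees (q : option nat) : set nat :=
  if q is Some q0 then [set q0] else [set q0 | (1 <= q0)%N].

Definition nil_counts (K : fieldType) (q : option nat) (n : nat) : set nat :=
  [set d | (1 <= d <= n ^ 2)%N /\ exists2 q0, degrees q q0 & h K q0 n d = 0%N].

Lemma d_minE (K : fieldType) n q : d_min K n q = nat_min (nil_counts K q n).
Proof.
rewrite /d_min; congr nat_min; apply/seteqP; split=> d [dn] /=.
  case: q => [q h0|h0]; split=> //; first by exists q.
  have [|[q q_gt0 hq] _] := @nat_minP [set h K q n d | q in [set q | (1 <= q)%N]].
    by exists (h K 1 n d), 1%N.
  by exists q => //; rewrite hq.
case=> q0; case: q => [q -> //|q0_gt0 h0] /=; split=> //.
have [|_] := @nat_minP [set h K q n d | q in [set q | (1 <= q)%N]].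
  by exists (h K q0 n d), q0.
by move=> /(_ 0%N) min0; apply/eqP; rewrite -leqn0; apply: min0; exists q0.
Qed.

Lemma d_min_le (K : fieldType) q q0 n d : (0 < n)%N -> degrees q q0 ->
  nilpotent K q0 n d -> (d_min K n q <= d)%N.
Proof.
move=> n_gt0 qq0 /(nilpotent_algebra n_gt0)[d' [d'd d'n rP]].
have d'P : nil_counts K q n d' by split=> //; exists q0 => //; apply/(h_eq0 _ _ d'n).
have [_ /(_ _ d'P) min_d'] := nat_minP (ex_intro _ d' d'P).
by rewrite d_minE (leq_trans min_d').
Qed.

Definition admissible_degree (q : option nat) : bool :=
  if q is Some q0 then (1 < q0)%N else true.

(** Degree 1 is excluded even for q = None: R_1 has dimension n > 0. *)
Lemma d_min_nilpotent (K : fieldType) q n :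
    (0 < n)%N -> admissible_degree q ->
  exists q0, [/\ degrees q q0, (1 < q0)%N & nilpotent K q0 n (d_min K n q)].
Proof.
move=> n_gt0 q_gt1.
have [q1 [qq1 q1_gt1]] : exists q1, degrees q q1 /\ (1 < q1)%N.
  by case: q q_gt1 => [q1 q1_gt1|_]; [exists q1 | exists 2].
have [d [_ d_n rP]] := nilpotent_algebra n_gt0 (nilpotent_all K n q1_gt1).
have ne : nil_counts K q n !=set0.
  by exists d; split=> //; exists q1 => //; apply/(h_eq0 _ _ d_n).
have [[dn [q0 qq0 /(h_eq0 K q0 dn)[r rP' r0]]] _] := nat_minP ne.
rewrite -d_minE in dn r rP' r0.
have nilr := quadratic_nil_at rP' r0.
exists q0; split=> //; last by exists (quad_coef r).
have q0_gt0 : (0 < q0)%N.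
  by move: qq0; case: (q) q_gt1 => [q' q'_gt1 ->|//]; apply: ltnW.
rewrite ltn_neqAle q0_gt0 andbT; apply/eqP => q0_1.
have ann1 : annihilates (fun=> quad_coef r) q0 (fun=> 1) by move=> u e v; rewrite -q0_1.
have one0 := nilr (fun=> 1) ann1 [:: Ordinal n_gt0] q0_1.
by have := oner_neq0 K; rewrite one0 eqxx.
Qed.

(** * Convergence of the densities *)

Lemma cvg_to_inf (R : realType) (u : nat -> R) :
    (forall n, (0 < n)%N -> 0 <= u n) ->
    (forall n N, (0 < n)%N -> (0 < N)%N -> u N <= u n + n.*2%:R / N%:R) ->
  u @ \oo --> inf [set u n | n in [set n | (0 < n)%N]].
Proof.
move=> u_ge0 u_le; set U := [set u n | n in _].
have U_lb : has_lbound U by exists 0 => _ [n n_gt0 <-]; apply: u_ge0.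
have U_inf : has_inf U by split=> //; exists (u 1%N), 1%N.
apply/cvgrPdist_lt => eps eps_gt0.
have eps2_gt0 : 0 < eps / 2 by rewrite divr_gt0.
have [_ [n n_gt0 <-] un] := inf_adherent eps2_gt0 U_inf.
near=> N.
have N_gt0 : (0 < N)%N by near: N; apply: nbhs_infty_gt.
have le_inf : inf U <= u N by apply: ge_inf => //; exists N.
have nN : n.*2%:R / N%:R < eps / 2.
  rewrite ltr_pdivrMr ?ltr0n // mulrC -ltr_pdivrMr //.
  have : (Num.truncn (n.*2%:R / (eps / 2)) < N)%N by near: N; apply: nbhs_infty_gt.
  rewrite -(ler_nat R); apply: lt_le_trans.
  by have /andP[] := truncn_itv (divr_ge0 (ler0n R n.*2) (ltW eps2_gt0)).
rewrite distrC ger0_norm ?subr_ge0 // ltrBlDl.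
by apply: le_lt_trans (u_le n N n_gt0 N_gt0) _; lra.
Unshelve. all: by end_near.
Qed.

Section Density.
Variables (R : realType) (K : fieldType) (q : option nat).
Hypothesis q_gt1 : admissible_degree q.

(** Write N = m n + k with k < n: blow up by m, then add k letters. *)
Lemma density_le n N : (0 < n)%N -> (0 < N)%N ->
  density R K q N <= density R K q n + n.*2%:R / N%:R.
Proof.
move=> n_gt0 N_gt0; have [q0 [qq0 q0_gt1 nilq]] := @d_min_nilpotent K q n n_gt0 q_gt1.
have NE := divn_eq N n; set m := (N %/ n)%N in NE; set k := (N %% n)%N in NE.
have kn : (k < n)%N by rewrite ltn_mod.
have := nilpotent_extend k q0_gt1 (nilpotent_blowup m nilq).
rewrite [(n * m)%N]mulnC -NE => /(d_min_le N_gt0 qq0).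
rewrite -(ler_nat R) natrD natrM natrX !natrM /density => dN.
have n0 : 0 < n%:R :> R by rewrite ltr0n.
have N0 : 0 < N%:R :> R by rewrite ltr0n.
rewrite ler_pdivrMr ?exprn_gt0 // (le_trans dN) // [leRHS]mulrDl lerD //.
  rewrite mulrAC -mulrA ler_wpM2l // ler_pdivlMr ?exprn_gt0 // -exprMn.
  by rewrite -natrM lerXn2r ?nnegrE // ler_nat NE leq_addr.
rewrite -mul2n natrM expr2 mulrA divfK ?gt_eqF // ler_wpM2r //.
by rewrite ler_wpM2l // ler_nat ltnW.
Qed.

Lemma density_cvg :
  density R K q @ \oo --> inf [set density R K q n | n in [set n | (0 < n)%N]].
Proof.
apply: cvg_to_inf => [n _|n N]; last exact: density_le.
by rewrite divr_ge0 ?exprn_ge0.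
Qed.

Lemma alphaE : alpha R K q = inf [set density R K q n | n in [set n | (0 < n)%N]].
Proof. apply: cvg_lim; [exact: Rhausdorff | exact: density_cvg]. Qed.

Lemma alpha_le q0 n d : degrees q q0 -> (0 < n)%N -> nilpotent K q0 n d ->
  alpha R K q <= d%:R / n%:R ^+ 2.
Proof.
move=> qq0 n_gt0 nilq; rewrite alphaE.
apply: (@le_trans _ _ (density R K q n)).
  apply: ge_inf; last by exists n.
  by exists 0 => _ [m _ <-]; rewrite divr_ge0 ?exprn_ge0.
by rewrite ler_wpM2r ?invr_ge0 ?exprn_ge0 // ler_nat (d_min_le n_gt0 qq0).
Qed.

Lemma alpha_ge a :
    (forall q0 n d, degrees q q0 -> (1 < q0)%N -> (0 < n)%N -> nilpotent K q0 n d ->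
       a * n%:R ^+ 2 <= d%:R) ->
  a <= alpha R K q.
Proof.
move=> a_le; rewrite alphaE; apply: lb_le_inf; first by exists (density R K q 1), 1%N.
move=> _ [n n_gt0 <-]; have [q0 [qq0 q0_gt1 nilq]] := @d_min_nilpotent K q n n_gt0 q_gt1.
by rewrite ler_pdivlMr ?exprn_gt0 ?ltr0n // (a_le _ _ _ qq0).
Qed.
End Density.

(** * The bounds on alpha *)

Lemma alpha4_ge (R : realType) (K : fieldType) :
  (3 - Num.sqrt 5) / 2 <= alpha R K (Some 4%N).
Proof.
set s := Num.sqrt 5; have s2 : s ^+ 2 = 5 :> R by rewrite sqr_sqrtr.
have s_ge0 : 0 <= s by apply: sqrtr_ge0.
apply: alpha_ge => // q0 n d -> _ n_gt0.
pose b := (3 - s) / 2 : R.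
apply: (@nilpotent_ge R K b (nth b [:: 1; 1 - b; b]) 2) => //.
- case=> [|[|[|//]]] _ /=; rewrite /b ?ltr01 //; nra.
- case=> [|[|//]] _ /=; rewrite ?divr1 //.
  have b1 : 0 < 1 - b by rewrite /b; nra.
  rewrite lerBrDr -lerBrDl ler_pdivrMr // /b; nra.
Qed.

Lemma alpha5_ge (R : realType) (K : fieldType) : 1 / 3 <= alpha R K (Some 5%N).
Proof.
apply: alpha_ge => // q0 n d -> _ n_gt0.
apply: (@nilpotent_ge R K (1 / 3) (nth 0 [:: 1; 2 / 3; 1 / 2; 1 / 3]) 3) => //=.
- by case=> [|[|[|[|//]]]] _ /=; lra.
- by case=> [|[|[|//]]] _ /=; lra.
Qed.

Lemma alpha_infty_ge (R : realType) (K : fieldType) : 1 / 4 <= alpha R K None.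
Proof.
apply: alpha_ge => // -[|[|q]] n d // _ _ n_gt0.
by apply: (@nilpotent_ge R K (1 / 4) (fun=> 1 / 2)) => // *; lra.
Qed.

Lemma alpha4_le (R : realType) (K : fieldType) : infinite_set [set: K] ->
  alpha R K (Some 4%N) <= (3 - Num.sqrt 5) / 2.
Proof.
move=> K_inf.
set s := Num.sqrt 5; have s2 : s ^+ 2 = 5 :> R by rewrite sqr_sqrtr.
have s_ge0 : 0 <= s by apply: sqrtr_ge0.
pose b := (3 - s) / 2 : R.
have b_ge0 : 0 <= b by rewrite /b; nra.
have g_ge0 : 0 <= 1 - b by rewrite /b; nra.
have g2 : (1 - b) ^+ 2 = b by rewrite /b; nra.
suff le_p p : (0 < p)%N -> alpha R K (Some 4%N) <= b + 2 / p%:R.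
  apply/ler_addgt0Pr => eps eps_gt0.
  have e_ge0 : 0 <= 2 / eps by rewrite divr_ge0 // ltW.
  have /andP[_ lt_p] := truncn_itv e_ge0.
  apply: le_trans (le_p (Num.truncn (2 / eps)).+1 isT) _.
  rewrite lerD2l ler_pdivrMr ?ltr0n // mulrC -ler_pdivrMr //; exact: ltW.
move=> p_gt0; have p0 : 0 < p%:R :> R by rewrite ltr0n.
(* a / p is near (sqrt 5 - 1) / 2 = 1 - b, whose square is b; with p blocks of p
   letters, the rounding of a and the products inside blocks cost 1 / p each *)
pose a := Num.truncn (p%:R * (1 - b)).
have /andP[a_le a_gt] := truncn_itv (mulr_ge0 (ltW p0) g_ge0); rewrite -/a in a_le a_gt.
have ap : (a <= p)%N by rewrite -(ler_nat R) (le_trans a_le) // ler_piMr ?(ltW p0) // gerBl.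
pose d := maxn (a ^ 2) (p * (p - a)).
have d_le : d%:R <= b * p%:R ^+ 2 + p%:R.
  rewrite /d /maxn; case: ifP => _.
    rewrite natrM natrB //; rewrite -natr1 in a_gt; nra.
  rewrite natrX; apply: (@le_trans _ _ ((p%:R * (1 - b)) ^+ 2)).
    by rewrite lerXn2r ?nnegrE // mulr_ge0 // ltW.
  by rewrite exprMn g2 mulrC lerDl ltW.
have := @nilpotent4 K a (p - a) d p K_inf.
rewrite subnKC // leq_maxl leq_maxr => /(_ isT isT) nil4.
apply: le_trans (alpha_le R (q := Some 4%N) isT erefl _ nil4) _.
  by rewrite muln_gt0 p_gt0.
rewrite ler_pdivrMr ?exprn_gt0 ?ltr0n ?muln_gt0 ?p_gt0 // natrD !natrM -!expr2.
have -> : (b + 2 / p%:R) * (p%:R ^+ 2) ^+ 2 =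
    p%:R ^+ 2 * (b * p%:R ^+ 2 + p%:R) + p%:R * p%:R ^+ 2.
  by field; rewrite gt_eqF.
by rewrite lerD2r ler_wpM2l ?exprn_ge0.
Qed.

Lemma alpha5_le (R : realType) (K : fieldType) :
  alpha R K (Some 5%N) <= 1 / 3.
Proof.
have := alpha_le R (q := Some 5%N) isT erefl (ltn0Sn 2) (nilpotent5 K).
by move/le_trans; apply; lra.
Qed.

Lemma alpha6_le (R : realType) (K : fieldType) :
  [pchar K] =i pred0 -> alpha R K (Some 6%N) <= 5 / 16.
Proof.
move=> K0.
have := alpha_le R (q := Some 6%N) isT erefl (ltn0Sn 3) (nilpotent6 K0).
by move/le_trans; apply; lra.
Qed.

Lemma alpha_infty_le6 (R : realType) (K : fieldType) :
  alpha R K None <= alpha R K (Some 6%N).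
Proof.
apply: alpha_ge => [//|q0 n d -> _ n_gt0 nil6].
rewrite -ler_pdivlMr ?exprn_gt0 ?ltr0n //.
exact: (alpha_le R (q := None) isT _ n_gt0 nil6).
Qed.

Theorem theorem1p5 (R : realType) :
  (forall K : fieldType, infinite_set [set: K] ->
     alpha R K (Some 4%N) = (3 - Num.sqrt 5) / 2 /\
     alpha R K (Some 5%N) = 1 / 3) /\
  (forall K : fieldType, [pchar K] =i pred0 ->
     1 / 4 <= alpha R K None /\
     alpha R K None <= alpha R K (Some 6%N) /\
     alpha R K (Some 6%N) <= 5 / 16).
Proof.
split=> [K K_inf|K K0].
  split; apply/le_anti/andP; split.
  - exact: alpha4_le.
  - exact: alpha4_ge.
  - exact: alpha5_le.
  - exact: alpha5_ge.
by split; [exact: alpha_infty_ge | split; [exact: alpha_infty_le6 | exact: alpha6_le]].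
Qed.
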